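(* Let $V$ be a finite-dimensional real normed space, $m\ge 1$ an integer, $p\ge 1$ a real number, and let $\omega$ be a control. Then $C^{p\text{-}var}(G^{m}(V))$ (with the metric $d_{p\text{-}var}$) and $C^{\omega,p}(G^{m}(V))$ (with the metric $d_{\omega,p}$) are not separable.
   Context: $T^{(m)}(V)=\bigoplus_{n=0}^{m}V^{\otimes n}$ is the truncated tensor algebra with (truncated) product $\otimes$; $\mathcal{G}^{m}(V)$ is its Lie subalgebra generated by $V$ for the bracket $[a,b]=a\otimes b-b\otimes a$; $G^{m}(V)=\exp(\mathcal{G}^{m}(V))$ is the free nilpotent Lie group of step $m$ over $V$, with product $\otimes$ and neutral element $1$. The dilation is $\delta_{t}(1+v_{1}+\dots+v_{m})=1+tv_{1}+\dots+t^{m}v_{m}$, $v_i\in V^{\otimes i}$, $t\in\mathbb{R}$. $\|\cdot\|_{m}$ is a fixed symmetric subadditive homogeneous norm on $G^{m}(V)$, i.e. a function $G^m(V)\to[0,\infty)$ with $\|g\|_m=0$ iff $g=1$, $\|\delta_t g\|_m=|t|\,\|g\|_m$, $\|g\otimes h\|_m\le\|g\|_m+\|h\|_m$, $\|g^{-1}\|_m=\|g\|_m$ (for instance the Carnot–Caratheodory norm; all such norms are equivalent since $\dim V<\infty$). Set $d_{m}(g,h)=\|g^{-1}\otimes h\|_{m}$. A $G^m(V)$-valued path is a continuous map $[0,1]\to G^{m}(V)$ starting at $1$; for such a path $Y_{s,t}:=Y_{s}^{-1}\otimes Y_{t}$. A control is a continuous function $\omega:\{(s,t):0\le s\le t\le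 1\}\to[0,\infty)$ with $\omega(t,t)=0$ for all $t$ and $\omega(s,t)+\omega(t,u)\le\omega(s,u)$ for $s<t<u$. $d_{p\text{-}var}(x,y)=\sup_{D=(0=t_{0}<\cdots<t_{n}=1)}\big(\sum_{i=0}^{n-1}d_{m}(x_{t_{i},t_{i+1}},y_{t_{i},t_{i+1}})^{p}\big)^{1/p}$ and $d_{\omega,p}(x,y)=\sup_{0\le s<t\le 1}\frac{d_{m}(x_{s,t},y_{s,t})}{\omega(s,t)^{1/p}}$; $C^{p\text{-}var}(G^{m}(V))$ (resp. $C^{\omega,p}(G^{m}(V))$) is the set of $G^m(V)$-valued paths at finite $d_{p\text{-}var}$-distance (resp. $d_{\omega,p}$-distance) from the constant path $1$.
   Formalization: V is assumed nonzero, and non-separability of C^{ω,p}(G^m(V)) is claimed only when this space contains a path other than the constant path 1; otherwise (V = 0, or e.g. ω(s,t) = (t−s)² with p = 1) the space is a single point, hence separable. *)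

(* Defs.v *)
From HB Require Import structures.
From mathcomp Require Export all_boot all_order all_algebra.
From mathcomp Require Export all_classical all_reals all_analysis.
Set Implicit Arguments.
Unset Strict Implicit.
Unset Printing Implicit Defensive.
Import Order.TTheory GRing.Theory Num.Theory numFieldNormedType.Exports.
Local Open Scope classical_set_scope.
Local Open Scope ring_scope.

(* Finite-dimensional normed spaces. *)
#[short(type="normedVectType")]
HB.structure Definition NormedVector (R : numFieldType) :=
  {V of NormedModule R V & Vector R V}.

Section Tensors.
Context {R : realType} {V : normedVectType R}.

(* Basis-free tensors: V being finite-dimensional, the k-th tensor power of V
   is the space of k-linear forms on the dual of V, where v1 ⊗ ... ⊗ vk maps
   (f1, ..., fk) to f1 v1 * ... * fk vk.  A formal series of tensors is given
   by its values on all finite sequences of linear forms, its component of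
   degree k being its restriction to the sequences of size k. *)
Definition tens := seq 'Hom(V, R^o) -> R^o.

Definition trunc_tensor (m : nat) : set tens :=
  [set a | (forall w, (m < size w)%N -> a w = 0) /\
           (forall u w f g (c : R),
              a (u ++ (c *: f + g) :: w) =
              c * a (u ++ f :: w) + a (u ++ g :: w))].

Definition tone : tens := fun w => (nilp w)%:R.

Definition tvec (v : V) : tens :=
  fun w => if w is [:: f] then f v else 0.

Definition tmul (m : nat) (a b : tens) : tens :=
  fun w => if (size w <= m)%N
           then \sum_(i < (size w).+1) a (take i w) * b (drop i w)
           else 0.

Definition tpow (m : nat) (a : tens) (k : nat) : tens :=
  iter k (tmul m a) tone.

Definition tbracket (m : nat) (a b : tens) : tens := tmul m a b - tmul m b a.

Definition texp (m : nat) (a : tens) : tens :=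
  \sum_(k < m.+1) (k`!%:R^-1 : R) *: tpow m a k.

(* The inverse of g when the component of degree 0 of g is 1: tone - g is then
   nilpotent. *)
Definition tinv (m : nat) (g : tens) : tens :=
  \sum_(k < m.+1) tpow m (tone - g) k.

Definition dilation (t : R) (a : tens) : tens :=
  fun w => t ^+ size w * a w.

Definition lie_subalgebra (m : nat) (L : set tens) : Prop :=
  [/\ L `<=` trunc_tensor m, L 0,
      (forall (c : R) a b, L a -> L b -> L (c *: a + b)) &
      (forall a b, L a -> L b -> L (tbracket m a b))].

Definition free_nilpotent_lie (m : nat) : set tens :=
  smallest (lie_subalgebra m) (range tvec).

Definition free_nilpotent_group (m : nat) : set tens :=
  texp m @` free_nilpotent_lie m.

Definition homogeneous_norm (m : nat) (N : tens -> R) : Prop :=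
  let G := free_nilpotent_group m in
  [/\ (forall g, G g -> 0 <= N g),
      (forall g, G g -> (N g = 0 <-> g = tone)),
      (forall (t : R) g, G g -> N (dilation t g) = `|t| * N g),
      (forall g h, G g -> G h -> N (tmul m g h) <= N g + N h) &
      (forall g, G g -> N (tinv m g) = N g)].

Definition gdist (m : nat) (N : tens -> R) (g h : tens) : R :=
  N (tmul m (tinv m g) h).

(* Paths are total functions on R, but only their values on [0, 1] matter.  The
   topology of the finite-dimensional space trunc_tensor m is that of pointwise
   convergence. *)
Definition group_path (m : nat) (x : R -> tens) : Prop :=
  [/\ (forall t, t \in `[0, 1] -> free_nilpotent_group m (x t)),
      (forall w, {within `[0, 1], continuous (fun t => x t w : R)}) &
      x 0 = tone].

Definition increment (m : nat) (x : R -> tens) (s t : R) : tens :=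
  tmul m (tinv m (x s)) (x t).

Definition dpvar (m : nat) (N : tens -> R) (p : R) (x y : R -> tens) : \bar R :=
  ereal_sup
    [set (let t := nth 1 (0 :: D) in
          ((\sum_(0 <= i < size D)
              gdist m N (increment m x (t i) (t i.+1))
                        (increment m y (t i) (t i.+1)) `^ p) `^ p^-1)%:E)
    | D in itv_partition 0 1].

(* The quotient is taken in the extended reals: when omega (s, t) = 0, it is 0
   if the numerator is 0 and +oo otherwise. *)
Definition domega (m : nat) (N : tens -> R) (omega : R * R -> R) (p : R)
    (x y : R -> tens) : \bar R :=
  ereal_sup
    [set ((gdist m N (increment m x st.1 st.2) (increment m y st.1 st.2))%:E
          / (omega st `^ p^-1)%:E)%E
    | st in [set st : R * R | [/\ 0 <= st.1, st.1 < st.2 & st.2 <= 1]]].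

Definition Cpvar (m : nat) (N : tens -> R) (p : R) : set (R -> tens) :=
  [set x | group_path m x /\ (dpvar m N p x (fun=> tone) < +oo)%E].

Definition Comega (m : nat) (N : tens -> R) (omega : R * R -> R) (p : R) :
    set (R -> tens) :=
  [set x | group_path m x /\ (domega m N omega p x (fun=> tone) < +oo)%E].

End Tensors.
Arguments tens {R} V.

Definition simplex {R : realType} : set (R * R) :=
  [set st | [/\ 0 <= st.1, st.1 <= st.2 & st.2 <= 1]].

Definition control {R : realType} (omega : R * R -> R) : Prop :=
  [/\ {within simplex, continuous omega},
      (forall st, simplex st -> 0 <= omega st),
      (forall t, 0 <= t <= 1 -> omega (t, t) = 0) &
      (forall s t u, 0 <= s -> s < t -> t < u -> u <= 1 ->
         omega (s, t) + omega (t, u) <= omega (s, u))].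

(* Separability of the set E for the (pseudo)metric d. *)
Definition separable {R : realType} {T : Type} (E : set T)
    (d : T -> T -> \bar R) : Prop :=
  exists D : set T,
    [/\ countable D, D `<=` E &
        forall x, E x -> forall e : R, 0 < e ->
          exists2 y, D y & (d x y < e%:E)%E].

(* Main.v *)
(** Two nearby points of a dense countable set would serve two members of an
    uncountable uniformly separated family, so such families are built for both
    metrics.  All their paths run along a single one-parameter subgroup
    c |-> exp (c v), on which the distance is a multiple of |b - a|, so they
    are given by real functions indexed by sequences e of bits.

    For the p-variation metric and p > 1, take the lacunary series
    sum_k e_k a^k dist(2^k t, Z) with a = 2^(-1/p): it is 1/p-Hoelder, and at
    the dyadic scale of the first index where two sequences differ the
    difference of the series has increments of size a^k / 2.  For p = 1, take
    the distribution functions of Cantor measures whose base-4 digits lie in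
    {e_k, e_k + 2}.

    For the omega-Hoelder metric, compose t |-> N (x t), where x is the given
    nontrivial path, with bumps supported on disjoint dyadic windows, each
    normalized to have omega-Hoelder constant 1, and let e select the windows.

    The triangle inequality for arbitrary paths of the dense set requires
    G^m(V) to be closed under products (Baker-Campbell-Hausdorff).  With D the
    derivation multiplying the degree k component by k, E = exp a exp b
    satisfies D E = E Y with Y in the Lie algebra, and solving this equation
    degree by degree writes E as an exponential. *)

Require Import Defs.
From HB Require Import structures.
From mathcomp Require Import lra ring zify.
Import Order.TTheory GRing.Theory Num.Theory numFieldNormedType.Exports.
Local Open Scope classical_set_scope.
Local Open Scope ring_scope.

Set Implicit Arguments.
Unset Strict Implicit.
Unset Printing Implicit Defensive.

(** * The ring of formal tensor series *)

(* Products of untruncated series satisfy exact identities; truncation at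
   degree m only enters when returning to the group. *)
Definition wser (R : realType) (W : Type) := seq W -> R^o.

Section WordSeries.
Variables (R : realType) (W : Type).
Implicit Types a b c : wser R W.

HB.instance Definition _ := GRing.Lmodule.copy (wser R W) (seq W -> R^o).

Definition wone : wser R W := fun w => (nilp w)%:R.

Definition wmul a b : wser R W :=
  fun w => \sum_(i < (size w).+1) a (take i w) * b (drop i w).

Lemma wmulE a b (w : seq W) :
  wmul a b w = \sum_(0 <= i < (size w).+1) a (take i w) * b (drop i w).
Proof. by rewrite big_mkord. Qed.

(** Both sides are sums over pairs of cuts [i <= j] of the word into three factors. *)
Lemma wmulA : associative wmul.
Proof.
move=> a b c; apply/funext => w; rewrite [RHS]wmulE [LHS]wmulE.
transitivity (\sum_(0 <= i < (size w).+1) \sum_(0 <= j < (size w).+1 | (i <= j)%N)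
    a (take i w) * (b (take (j - i) (drop i w)) * c (drop j w))).
  apply: eq_big_nat => i /andP[_ ilt]; rewrite wmulE mulr_sumr size_drop.
  rewrite [RHS]big_mkcond [RHS](big_cat_nat (n := i)) ?leq0n//=; last exact: ltnW.
  rewrite [X in _ = X + _]big_nat_cond [X in _ = X + _]big1 ?add0r; last first.
    by move=> k /andP[/andP[_ kl] _]; rewrite leqNgt kl.
  rewrite -[X in _ = \sum_(X <= _ < _) _](add0n i) big_addn subSn//; apply: eq_big_nat => k kl.
  by rewrite leq_addl addnK drop_drop.
rewrite (exchange_big_dep_nat xpredT)//=.
apply: eq_big_nat => j /andP[_ jlt]; rewrite wmulE mulr_suml.
have sj : size (take j w) = j by rewrite size_take_min; apply/minn_idPl.
rewrite sj big_mkcond (big_cat_nat (n := j.+1)) ?leq0n//=.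
rewrite [X in _ + X]big_nat_cond [X in _ + X]big1 ?addr0; last first.
  by move=> k /andP[/andP[kl _] _]; rewrite leqNgt kl.
apply: eq_big_nat => i /andP[_ il]; rewrite -ltnS il mulrA take_takel//.
by rewrite take_drop subnK.
Qed.

Lemma wmul1 : left_id wone wmul.
Proof.
move=> a; apply/funext => w; rewrite wmulE big_nat_recl// take0 drop0 /wone/= mul1r.
rewrite big_nat_cond big1 ?addr0// => i /andP[/andP[_ il] _].
by case: w il => // x w il; rewrite /= mul0r.
Qed.

Lemma wmulr1 : right_id wone wmul.
Proof.
move=> a; apply/funext => w; rewrite wmulE big_nat_recr//= take_size drop_size mulr1.
rewrite big_nat_cond big1 ?add0r// => i /andP[/andP[_ il] _].
by rewrite /wone /nilp size_drop subn_eq0 leqNgt il mulr0.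
Qed.

Lemma wmulDl : left_distributive wmul +%R.
Proof.
move=> a b c; apply/funext => w; rewrite [LHS]wmulE.
under eq_bigr do rewrite mulrDl.
by rewrite big_split -!wmulE.
Qed.

Lemma wmulDr : right_distributive wmul +%R.
Proof.
move=> a b c; apply/funext => w; rewrite [LHS]wmulE.
under eq_bigr do rewrite mulrDr.
by rewrite big_split -!wmulE.
Qed.

Lemma wone_neq0 : wone != 0.
Proof.
by apply/eqP => /(congr1 (fun f => f [::])) /eqP; rewrite /wone/= (oner_eq0 R).
Qed.

HB.instance Definition _ := GRing.Zmodule_isNzRing.Build (wser R W)
  wmulA wmul1 wmulr1 wmulDl wmulDr wone_neq0.

Lemma wscaleAl (k : R) a b : k *: (a * b) = (k *: a) * b.
Proof.
apply/funext => w; rewrite [RHS]wmulE.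
under eq_bigr do rewrite -mulrA.
by rewrite -mulr_sumr -wmulE.
Qed.

HB.instance Definition _ :=
  GRing.Lmodule_isLalgebra.Build R (wser R W) wscaleAl.

Lemma wscaleAr (k : R) a b : k *: (a * b) = a * (k *: b).
Proof.
apply/funext => w; rewrite [RHS]wmulE.
under eq_bigr do rewrite mulrCA.
by rewrite -mulr_sumr -wmulE.
Qed.

HB.instance Definition _ :=
  GRing.Lalgebra_isAlgebra.Build R (wser R W) wscaleAr.

End WordSeries.

(** * The filtration by order, series of increasing order, and the exponential *)

Section OrderIdeals.
Variables (R : realType) (W : Type).
Implicit Types (a b c u : wser R W) (x y : nat -> wser R W) (w : seq W).

(** Series of order at least [k] form a two-sided ideal; congruence modulo [wideal m.+1] is equality
    after truncation at degree [m], and congruence modulo all of them is equality ([wideal_eqP]). *)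
Definition wideal (k : nat) a := forall w, (size w < k)%N -> a w = 0.

Lemma wmulrE a b w : (a * b) w = \sum_(i < (size w).+1) a (take i w) * b (drop i w).
Proof. by []. Qed.

Lemma wsumE I (r : seq I) (P : pred I) (F : I -> wser R W) w :
  (\sum_(i <- r | P i) F i) w = \sum_(i <- r | P i) F i w.
Proof. by elim/big_ind2 : _ => // a s b t <- <-. Qed.

Lemma wone_cons w : (0 < size w)%N -> (1 : wser R W) w = 0.
Proof. by case: w. Qed.

Lemma wideal0 k : wideal k (0 : wser R W). Proof. by []. Qed.

Lemma wideal_le k l a : (k <= l)%N -> wideal l a -> wideal k a.
Proof. by move=> kl al w wk; apply: al; exact: leq_trans kl. Qed.

Lemma widealD k a b : wideal k a -> wideal k b -> wideal k (a + b).
Proof. by move=> ak bk w wk; rewrite -[LHS]/(a w + b w) ak// bk// addr0. Qed.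

Lemma widealZ k (t : R) a : wideal k a -> wideal k (t *: a).
Proof. by move=> ak w wk; rewrite -[LHS]/(t * a w) ak// mulr0. Qed.

Lemma widealN k a : wideal k a -> wideal k (- a).
Proof. by rewrite -scaleN1r; exact: widealZ. Qed.

Lemma widealB k a b : wideal k a -> wideal k b -> wideal k (a - b).
Proof. by move=> ak bk; apply: widealD => //; apply: widealN. Qed.

Lemma wideal_sum k I (r : seq I) (P : pred I) (F : I -> wser R W) :
  (forall i, P i -> wideal k (F i)) -> wideal k (\sum_(i <- r | P i) F i).
Proof. by move=> H; elim/big_ind : _ => //; exact: widealD. Qed.

Lemma widealM k l a b : wideal k a -> wideal l b -> wideal (k + l) (a * b).
Proof.
move=> ak bl w wk; rewrite wmulrE big1// => i _.
have [ik|ik] := ltnP i k.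
  by rewrite ak ?mul0r// (leq_ltn_trans _ ik)// size_take_min geq_minl.
rewrite [X in _ * X]bl ?mulr0// size_drop.
  move: wk (ltn_ord i) ik; clear; lia.
Qed.

Lemma wideal_exp a n : wideal 1 a -> wideal n (a ^+ n).
Proof.
by move=> a1; elim: n => // n ih; rewrite exprS -add1n; exact: widealM.
Qed.

Lemma wideal_eqP a b : (forall k, wideal k (a - b)) -> a = b.
Proof.
move=> h; apply/funext => w; apply/eqP; rewrite -subr_eq0; apply/eqP.
exact: (h (size w).+1).
Qed.

(* The sum of the series x, provided that x_k has order at least k. *)
Definition isum x : wser R W := fun w => \sum_(k < (size w).+1) x k w.

Definition adapted x := forall k, wideal k (x k).

Lemma isum_approx x n : adapted x -> wideal n (isum x - \sum_(k < n) x k).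
Proof.
move=> hx w wn; rewrite -[LHS]/(isum x w - (\sum_(k < n) x k) w) wsumE /isum.
apply/eqP; rewrite subr_eq0; apply/eqP.
rewrite -!(big_mkord xpredT (fun k => x k w)) [RHS](big_cat_nat (n := (size w).+1))//=.
rewrite [X in _ = _ + X]big_nat_cond [X in _ = _ + X]big1 ?addr0//.
by move=> k /andP[/andP[wk _] _]; rewrite hx.
Qed.

Definition cauchy x y n := \sum_(j < n.+1) x (n - j)%N * y j.

Lemma adapted_cauchy x y : adapted x -> adapted y -> adapted (cauchy x y).
Proof.
move=> hx hy n; apply: wideal_sum => -[j/=]; rewrite ltnS => jn _.
by rewrite -{1}(subnK jn); exact: widealM.
Qed.

(** Modulo [wideal n] both factors are finite sums, and the products [x i * y j] that the Cauchy
    terms below [n] leave out have [n <= i + j], hence order at least [n]. *)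
Lemma isumM x y : adapted x -> adapted y -> isum x * isum y = isum (cauchy x y).
Proof.
move=> hx hy; apply: wideal_eqP => n.
set X := \sum_(k < n) x k; set Y := \sum_(k < n) y k.
have hXY : wideal n (isum x * isum y - X * Y).
  have -> : isum x * isum y - X * Y = (isum x - X) * isum y + X * (isum y - Y).
    by rewrite mulrBl mulrBr addrA subrK.
  apply: widealD.
    by rewrite -[X in wideal X _]addn0; apply: widealM => //; exact: isum_approx.
  by rewrite -[X in wideal X _]add0n; apply: widealM => //; exact: isum_approx.
have hC := isum_approx (n := n) (adapted_cauchy hx hy).
have hXC : wideal n (X * Y - \sum_(k < n) cauchy x y k).
  have -> : X * Y = \sum_(i < n) \sum_(j < n) x i * y j.
    by rewrite /X mulr_suml; apply: eq_bigr => i _; rewrite mulr_sumr.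
  have -> : \sum_(k < n) cauchy x y k =
      \sum_(i < n) \sum_(j < n | (i + j < n)%N) x i * y j.
    rewrite (exchange_big_dep xpredT)//= -(big_mkord xpredT (fun k => cauchy x y k)).
    transitivity (\sum_(0 <= k < n) \sum_(0 <= j < n | (j < k.+1)%N) x (k - j)%N * y j).
      apply: eq_big_nat => k kn; rewrite /cauchy.
      by rewrite -(big_mkord xpredT (fun j => x (k - j)%N * y j)) (big_nat_widen _ _ n).
    rewrite (exchange_big_dep_nat xpredT)//= big_mkord; apply: eq_bigr => j _.
    transitivity (\sum_(j <= k < n) x (k - j)%N * y j).
      rewrite big_mkcond (big_cat_nat (n := j))//=; last exact: ltnW.
      rewrite [X in X + _]big_nat_cond [X in X + _]big1 ?add0r; last first.
        by move=> k /andP[/andP[_ kj] _]; rewrite ltnS leqNgt kj.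
      by apply: eq_big_nat => k /andP[jk _]; rewrite ltnS jk.
    rewrite -(add0n j) big_addn.
    rewrite -(big_mkord (fun k => (k + j < n)%N) (fun k => x k * y j)).
    rewrite (big_nat_widen _ _ n) ?leq_subr// add0n.
    by apply: eq_big => [i|i _]; [rewrite /= ltn_subRL addnC|rewrite addnK].
  rewrite -sumrB; apply: wideal_sum => i _.
  rewrite [X in X - _](bigID (fun j : 'I_n => (i + j < n)%N))/= addrAC subrr add0r.
  apply: wideal_sum => j; rewrite -leqNgt => ij.
  by apply: wideal_le ij _; exact: widealM.
have -> : isum x * isum y - isum (cauchy x y) =
    (isum x * isum y - X * Y) + ((X * Y - \sum_(k < n) cauchy x y k)
      - (isum (cauchy x y) - \sum_(k < n) cauchy x y k)).
  by rewrite [in RHS]opprB addrA [X in _ = X + _]addrA subrK addrA subrK.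
by apply: widealD => //; exact: widealB.
Qed.

Definition expterm a (k : nat) : wser R W := (k`!%:R^-1 : R) *: a ^+ k.

Definition wexp a := isum (expterm a).

Lemma adapted_exp a : wideal 1 a -> adapted (expterm a).
Proof. by move=> a1 k; apply: widealZ; exact: wideal_exp. Qed.

Lemma fact_neq0 n : n`!%:R != 0 :> R.
Proof. by rewrite pnatr_eq0 -lt0n fact_gt0. Qed.

Lemma bin_invfact n j : (j <= n)%N ->
  (n`!%:R^-1 : R) * 'C(n, j)%:R = (n - j)`!%:R^-1 * j`!%:R^-1.
Proof.
move=> jn; rewrite -(bin_fact jn) !natrM.
have : 'C(n, j)%:R != 0 :> R by rewrite pnatr_eq0 -lt0n bin_gt0.
by move: (fact_neq0 j) (fact_neq0 (n - j)) => ? ? ?; field; apply/and3P.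
Qed.

(** Both exponents are multiples of the same [a], so the Cauchy product reduces to the binomial
    theorem for the scalar [s + t]. *)
Lemma wexpD a (s t : R) : wideal 1 a ->
  wexp (s *: a) * wexp (t *: a) = wexp ((s + t) *: a).
Proof.
move=> a1; rewrite isumM; [|by apply: adapted_exp; exact: widealZ..].
congr isum; apply/funext => n; rewrite /cauchy /expterm exprZn exprDn scaler_suml scaler_sumr.
apply: eq_bigr => -[j/=]; rewrite ltnS => jn _.
rewrite !exprZn -!scalerAl -!scalerAr !scalerA -exprD subnK//; congr (_ *: _).
transitivity (((n - j)`!%:R^-1 * j`!%:R^-1) * (s ^+ (n - j) * t ^+ j)); first by ring.
by rewrite -bin_invfact// -mulrA mulr_natl.
Qed.

Lemma wexp0 : wexp 0 = 1.
Proof.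
apply/funext => w; rewrite /wexp /isum /expterm big_ord_recl/= expr0 fact0 invr1 scale1r.
by rewrite big1 ?addr0// => i _; rewrite expr0n scaler0.
Qed.

Lemma wexp_approx1 a : wideal 1 a -> wideal 1 (wexp a - 1).
Proof.
move=> a1; have := isum_approx (n := 1) (adapted_exp a1).
by rewrite big_ord1 /expterm expr0 fact0 invr1 scale1r.
Qed.

Lemma wexpNr a : wideal 1 a -> wexp a * wexp (- a) = 1.
Proof.
by move=> a1; rewrite -[a in X in X * _]scale1r -scaleN1r wexpD// subrr scale0r wexp0.
Qed.

Lemma wexpNl a : wideal 1 a -> wexp (- a) * wexp a = 1.
Proof.
by move=> a1; rewrite -[a in X in _ * X]scale1r -scaleN1r wexpD// addNr scale0r wexp0.
Qed.

End OrderIdeals.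

(** * Derivations and the Baker-Campbell-Hausdorff theorem *)

Section Derivations.
Variables (R : realType) (W : Type).
Implicit Types (a b c u : wser R W) (w : seq W).

(** Preserving the order of series stands for continuity: it lets [d] pass through the infinite sums
    [isum]. *)
Definition derivation (d : wser R W -> wser R W) :=
  [/\ (forall (t : R) a b, d (t *: a + b) = t *: d a + d b),
      (forall a b, d (a * b) = d a * b + a * d b) &
      (forall k a, wideal k a -> wideal k (d a))].

(** This is minus the usual ad_b. With this sign no alternating factors appear when derivatives are
    written to the right of the exponential. *)
Definition wad b u := u * b - b * u.

Definition wadn b u j := iter j (wad b) u.

Lemma wideal_wadn b u j : wideal 1 b -> wideal j (wadn b u j).
Proof.
move=> b1; elim: j => // j ih; rewrite /wadn iterS -/(wadn b u j).
by apply: widealB; [rewrite -addn1|rewrite -add1n]; exact: widealM.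
Qed.

Definition phiterm b u (j : nat) : wser R W := (j.+1`!%:R^-1 : R) *: wadn b u j.

(** The operator (1 - exp(-ad_b)) / ad_b applied to [u]. *)
Definition wphi b u := isum (phiterm b u).

Lemma adapted_phi b u : wideal 1 b -> adapted (phiterm b u).
Proof. by move=> b1 j; apply: widealZ; exact: wideal_wadn. Qed.

Variable d : wser R W -> wser R W.
Hypothesis hd : derivation d.

Lemma derivZ (t : R) a : d (t *: a) = t *: d a.
Proof.
have [h _ _] := hd.
have d0 : d 0 = 0.
  have /eqP := h 1 0 0; rewrite scaler0 addr0 scale1r addrC -subr_eq subrr eq_sym.
  by move=> /eqP.
by rewrite -[t *: a]addr0 h d0 addr0.
Qed.

Lemma derivD a b : d (a + b) = d a + d b.
Proof. by have [h _ _] := hd; rewrite -[a in LHS]scale1r h scale1r. Qed.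

Lemma derivB a b : d (a - b) = d a - d b.
Proof. by rewrite derivD -[X in _ = _ + X]scaleN1r -derivZ scaleN1r. Qed.

Lemma deriv_sum n (F : nat -> wser R W) : d (\sum_(i < n) F i) = \sum_(i < n) d (F i).
Proof.
elim: n => [|n ih]; last by rewrite !big_ord_recr/= derivD ih.
by rewrite !big_ord0 -[X in d X](scale0r 0) derivZ scale0r.
Qed.

Lemma deriv1 : d 1 = 0.
Proof.
have [_ h _] := hd; have /eqP := h 1 1.
by rewrite !mul1r mulr1 -subr_eq subrr eq_sym => /eqP.
Qed.

(** All factors [b] are moved to the left of the differentiated one by u b = b u + [wad b u]; the
    coefficients then follow Pascal's rule. *)
Lemma deriv_exp b n :
  d (b ^+ n) = \sum_(j < n) 'C(n, j.+1)%:R *: (b ^+ (n - j.+1) * wadn b (d b) j).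
Proof.
have [_ hM _] := hd.
elim: n => [|n ih]; first by rewrite big_ord0 expr0 deriv1.
rewrite exprSr hM ih mulr_suml.
rewrite -(big_mkord xpredT (fun j => 'C(n, j.+1)%:R *: (b ^+ (n - j.+1) * wadn b (d b) j) * b)).
rewrite -(big_mkord xpredT (fun j => 'C(n.+1, j.+1)%:R *: (b ^+ (n.+1 - j.+1) * wadn b (d b) j))).
transitivity (\sum_(0 <= j < n) ('C(n, j.+1)%:R *: (b ^+ (n - j) * wadn b (d b) j) +
   'C(n, j.+1)%:R *: (b ^+ (n - j.+1) * wadn b (d b) j.+1)) + b ^+ n * d b).
  congr (_ + _); apply: eq_big_nat => j /andP[_ jn].
  rewrite -scalerDr -scalerAl; congr (_ *: _).
  rewrite -[in b ^+ (n - j)](subnSK jn) exprSr -!mulrA -mulrDr /wadn iterS /wad.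
  by rewrite addrC subrK.
rewrite big_split/= -addrA.
have -> : \sum_(0 <= j < n) 'C(n, j.+1)%:R *: (b ^+ (n - j) * wadn b (d b) j) =
   \sum_(0 <= j < n.+1) 'C(n, j.+1)%:R *: (b ^+ (n - j) * wadn b (d b) j).
  by rewrite big_nat_recr//= bin_small// scale0r addr0.
have -> : \sum_(0 <= j < n) 'C(n, j.+1)%:R *: (b ^+ (n - j.+1) * wadn b (d b) j.+1)
    + b ^+ n * d b = \sum_(0 <= j < n.+1) 'C(n, j)%:R *: (b ^+ (n - j) * wadn b (d b) j).
  by rewrite [RHS]big_nat_recl//= bin0 scale1r subn0 addrC.
rewrite -big_split/=; apply: eq_bigr => j _.
by rewrite -scalerDl binS natrD subSS.
Qed.

(** Dividing [deriv_exp] by n! splits each binomial coefficient into 1/(n-j-1)! and 1/(j+1)!, which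
    are the coefficients of [expterm] and [phiterm]; the two sides are compared modulo every order
    ideal. *)
Lemma deriv_wexp b : wideal 1 b -> d (wexp b) = wexp b * wphi b (d b).
Proof.
move=> b1; have [_ _ hI] := hd.
rewrite /wexp /wphi isumM; [|exact: adapted_exp|exact: adapted_phi].
apply: wideal_eqP => n.
set E := isum _; pose x := expterm b; set Q := cauchy _ _.
have hQ : adapted Q by apply: adapted_cauchy; [exact: adapted_exp|exact: adapted_phi].
(* Differentiation lowers the index by one: the constant term disappears and term [k.+1] yields the
   k-th Cauchy term, hence the unequal lengths of the two sums. *)
have dE : d (\sum_(k < n.+1) x k) = \sum_(k < n) Q k.
  have x0 : d (x 0) = 0 by rewrite /x /expterm derivZ expr0 deriv1 scaler0.
  rewrite (deriv_sum _ x) big_ord_recl x0 add0r /x.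
  apply: eq_bigr => k _; rewrite /expterm derivZ deriv_exp /= /bump/= add1n scaler_sumr.
  apply: eq_bigr => -[j/=]; rewrite ltnS => jk _.
  rewrite -scalerAl -scalerAr !scalerA subSS; congr (_ *: _).
  by rewrite bin_invfact ?subSS.
have -> : d E - isum Q = d (E - \sum_(k < n.+1) x k) - (isum Q - \sum_(k < n) Q k).
  by rewrite derivB dE opprB addrA subrK.
apply: widealB; last exact: isum_approx.
by apply: hI; apply: wideal_le (isum_approx (n := n.+1) (adapted_exp b1)).
Qed.

End Derivations.

(** * The grading derivation, inner derivations and homogeneous components *)

Section Grading.
Variables (R : realType) (W : Type).
Implicit Types (a b c u : wser R W) (w : seq W).

Definition wdeg a : wser R W := fun w => (size w)%:R * a w.

Lemma derivation_wdeg : derivation wdeg.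
Proof.
split.
- by move=> t a b; apply/funext => w; rewrite /wdeg -[RHS]/(t * _ + _)
    -[(_ + _) w]/(t * a w + b w) mulrDr mulrCA.
- move=> a b; apply/funext => w; rewrite -[RHS]/(_ w + _ w) !wmulrE -big_split/=.
  rewrite {1}/wdeg wmulrE mulr_sumr; apply: eq_bigr => -[i/=]; rewrite ltnS => iw _.
  rewrite /wdeg size_takel// size_drop -[in LHS](subnKC iw) natrD mulrDl.
  by rewrite -!mulrA; congr (_ + _); rewrite mulrCA.
- by move=> k a ak w wk; rewrite /wdeg ak// mulr0.
Qed.

Lemma derivation_wad u : derivation (fun a => wad u a).
Proof.
rewrite /wad; split.
- by move=> t a b; rewrite mulrDl mulrDr -scalerAl -scalerAr scalerBr opprD addrACA.
- by move=> a b; rewrite mulrBl mulrBr !mulrA [RHS]addrC addrA subrK.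
- by move=> k a ak; apply: widealB; [rewrite -(addn0 k)|rewrite -(add0n k)];
    apply: widealM => //; rewrite ?addn0.
Qed.

(** [deriv_wexp] for the inner derivation [wad u]. It carries a logarithmic derivative from one side
    of an exponential to the other. *)
Lemma wexp_conj b u : wideal 1 b ->
  u * wexp b = wexp b * (u - wphi b (wad u b)).
Proof.
move=> b1; rewrite mulrBr -(deriv_wexp (derivation_wad u) b1) /wad.
by rewrite opprB addrC subrK.
Qed.

Definition whom k a : wser R W := fun w => if size w == k then a w else 0.

Lemma whom_mul k a b : whom k (a * b) = \sum_(i < k.+1) whom i a * whom (k - i)%N b.
Proof.
apply/funext => w; rewrite wsumE /whom wmulrE; case: eqP => [<-|/eqP wk].
  apply: eq_bigr => -[i/=]; rewrite ltnS => iw _; rewrite wmulrE (bigD1 (Ordinal (iw : i < (size w).+1)%N))//=.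
  rewrite size_takel// size_drop !eqxx big1 ?addr0// => -[j jw] jni.
  rewrite size_takel; last by rewrite -ltnS.
  rewrite ifF ?mul0r//; apply/negbTE.
  by apply: contra jni => /eqP ji; apply/eqP/val_inj.
rewrite big1// => -[i/=]; rewrite ltnS => ik _; rewrite wmulrE big1// => -[j/=].
rewrite ltnS => jw _; rewrite size_takel// size_drop.
case: eqP => [ji|_]; last by rewrite mul0r.
case: eqP => [h|_]; last by rewrite mulr0.
by case/eqP: wk; move: h ik jw; rewrite ji; lia.
Qed.

Lemma whom_sum_approx n a : wideal n (a - \sum_(k < n) whom k a).
Proof.
move=> w wn; rewrite -[LHS]/(a w - (\sum_(k < n) whom k a) w) wsumE.
rewrite (bigD1 (Ordinal wn))//= {1}/whom eqxx big1 ?addr0 ?subrr// => k kw.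
rewrite /whom ifF//; apply/negbTE; apply: contra kw => /eqP kw.
by apply/eqP/val_inj.
Qed.

End Grading.

(** * Products of exponentials of a graded Lie algebra *)

Section BCH.
Variables (R : realType) (W : Type) (m : nat) (L : set (wser R W)).
Implicit Types (a b c u : wser R W) (w : seq W).

(** Since every series of order above [m] belongs to [L], a series approximated by elements of [L]
    up to that order is itself in [L]; infinite sums of brackets therefore stay in [L]. *)
Definition graded_lie :=
  [/\ (forall a, L a -> wideal 1 a),
      (forall a, wideal m.+1 a -> L a),
      (forall (t : R) a b, L a -> L b -> L (t *: a + b)),
      (forall a b, L a -> L b -> L (wad a b)) &
      (forall k a, L a -> L (whom k a))].

Hypothesis hL : graded_lie.

Let L0 : L 0. Proof. by have [_ + _ _ _] := hL; apply; exact: wideal0. Qed.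

Let LD a b : L a -> L b -> L (a + b).
Proof. by have [_ _ h _ _] := hL => la lb; rewrite -[a]scale1r; exact: h. Qed.

Let LZ (t : R) a : L a -> L (t *: a).
Proof. by have [_ _ h _ _] := hL => la; rewrite -[_ *: _]addr0; apply: h. Qed.

Let LB a b : L a -> L b -> L (a - b).
Proof. by move=> la lb; apply: LD => //; rewrite -scaleN1r; exact: LZ. Qed.

Let Lsum n (F : nat -> wser R W) : (forall i, L (F i)) -> L (\sum_(i < n) F i).
Proof. by move=> h; elim/big_ind : _ => //; exact: LD. Qed.

Let Lapprox a b : L b -> wideal m.+1 (a - b) -> L a.
Proof.
have [_ h _ _ _] := hL => lb /h lab; rewrite -(subrK b a); exact: LD.
Qed.

Let Lisum x : adapted x -> (forall j, L (x j)) -> L (isum x).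
Proof.
by move=> hx lx; apply: (Lapprox (Lsum m.+1 lx)); exact: isum_approx.
Qed.

Let Lphi b u : L b -> L u -> L (wphi b u).
Proof.
move=> lb lu; have [h1 _ _ hB _] := hL.
apply: Lisum => [|j]; first by apply: adapted_phi; exact: h1.
apply: LZ; elim: j => // j ih; rewrite /wadn iterS; exact: hB.
Qed.

Let Lwdeg a : L a -> L (wdeg a).
Proof.
move=> la; have [_ _ _ _ hh] := hL.
apply: (Lapprox (Lsum m.+1 (F := fun k => k%:R *: whom k a) _)).
  by move=> k; apply: LZ; exact: hh.
have -> : \sum_(k < m.+1) (k%:R : R) *: whom k a = \sum_(k < m.+1) whom k (wdeg a).
  apply: eq_bigr => k _; apply/funext => w; rewrite -[LHS]/(k%:R * _) /whom /wdeg.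
  by case: eqP => [->//|_]; rewrite mulr0.
exact: whom_sum_approx.
Qed.

(** In powers with exponent at least two, every product containing [f] has another factor of order
    at least one, so in degree [k] only the linear term of the exponential sees [f]. *)
Lemma wexp_add_approx c f k : (0 < k)%N -> wideal 1 c -> wideal k f ->
  wideal k.+1 (wexp (c + f) - wexp c - f).
Proof.
move=> k0 c1 fk.
have f1 : wideal 1 f by exact: wideal_le fk.
have cf1 : wideal 1 (c + f) by exact: widealD.
have hn n : wideal k.+1 ((c + f) ^+ n.+2 - c ^+ n.+2).
  have hs i : (c + f) ^+ i.+1 - c ^+ i.+1 =
      (c + f) * ((c + f) ^+ i - c ^+ i) + f * c ^+ i.
    by rewrite [in RHS]mulrBr -!exprS mulrDl -exprS opprD addrA subrK.
  elim: n => [|n ih].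
    rewrite hs !expr1 [c + f - c]addrAC subrr add0r; apply: widealD; rewrite -addn1.
      by rewrite addnC; exact: widealM.
    exact: widealM.
  rewrite hs; apply: widealD.
    by apply: (@wideal_le _ _ _ (1 + k.+1)) => //; exact: widealM.
  apply: (@wideal_le _ _ _ (k + n.+2)); first by rewrite -addSnnS leq_addr.
  by apply: widealM => //; exact: wideal_exp.
pose x := @expterm R W.
have hx a : wideal 1 a -> wideal k.+1 (wexp a - \sum_(j < k.+1) x a j).
  by move=> a1; apply: isum_approx; exact: adapted_exp.
have -> : wexp (c + f) - wexp c - f =
  (wexp (c + f) - \sum_(j < k.+1) x (c + f) j) - (wexp c - \sum_(j < k.+1) x c j) +
  (\sum_(j < k.+1) x (c + f) j - \sum_(j < k.+1) x c j - f).
  by rewrite opprD [X in _ = X + _]addrACA -opprD [RHS]addrA subrK.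
apply: widealD; first by apply: widealB; exact: hx.
have -> : \sum_(j < k.+1) x (c + f) j - \sum_(j < k.+1) x c j - f =
   \sum_(j < k.-1) (x (c + f) j.+2 - x c j.+2).
  rewrite -sumrB -(prednK k0) !big_ord_recl/= /bump/= /x /expterm !expr0 subrr add0r.
  rewrite -[(1 + 0)%N]/1%N !expr1 -[1`!]/1%N invr1 !scale1r.
  by rewrite [c + f - c]addrAC subrr add0r addrAC subrr add0r.
apply: wideal_sum => j _; rewrite /x /expterm -scalerBr; apply: widealZ; exact: hn.
Qed.

(* Since D := wdeg is k on the component of degree k, comparing the components
   of degree k of D E = E Y and of D (exp c) = exp c * phi_c (D c) expresses
   the first discrepancy between E and exp c as an element of L. *)
Lemma wexp_of_logderiv (E Y : wser R W) k : wideal 1 (E - 1) -> L Y ->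
  wdeg E = E * Y -> exists2 c, L c & wideal k.+1 (E - wexp c).
Proof.
move=> E1 LY hE; have [h1 _ _ _ hh] := hL.
elim: k => [|k [c Lc hc]]; first by exists 0; rewrite ?wexp0.
have c1 := h1 _ Lc.
set Z := Y - wphi c (wdeg c).
have LZ' : L Z by apply: LB => //; apply: Lphi => //; exact: Lwdeg.
have hD : wdeg (E - wexp c) - (E - wexp c) * Y = wexp c * Z.
  have hd := derivation_wdeg R W.
  rewrite (derivB hd) hE (deriv_wexp hd)//.
  by rewrite /Z mulrBl mulrBr opprD [LHS]addrACA subrr add0r opprK addrC.
have hdk : wideal k.+1 (wdeg (E - wexp c)) by have [_ _] := derivation_wdeg R W; exact.
(* [Y] has order at least one, so the product of the discrepancy with [Y] does not contribute in
   degree [k.+1]. *)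
have hYk : wideal k.+2 ((E - wexp c) * Y) by rewrite -[k.+2]addn1; apply: widealM => //; exact: h1.
have hZk : wideal k.+1 Z.
  rewrite -[Z]mul1r -(wexpNl c1) -mulrA -hD -(add0n k.+1); apply: widealM => //.
  by apply: widealB => //; exact: wideal_le hYk.
pose f := (k.+1%:R^-1 : R) *: whom k.+1 Z.
have Lf : L f by apply: LZ; exact: hh.
have fk : wideal k.+1 f.
  by apply: widealZ => w wk; rewrite /whom ifF//; apply/negbTE; rewrite neq_ltn wk.
exists (c + f); first exact: LD.
have -> : E - wexp (c + f) = (E - wexp c - f) - (wexp (c + f) - wexp c - f).
  by rewrite opprB addrA subrK opprB addrA subrK.
apply: widealB; last exact: wexp_add_approx.
move=> w; rewrite ltnS leq_eqVlt => /orP[/eqP wk|wk]; last first.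
  by apply: (@widealB _ _ k.+1).
have hw : (wexp c * Z) w = Z w.
  have h : wideal k.+2 ((wexp c - 1) * Z).
    by rewrite -add1n; apply: widealM => //; exact: wexp_approx1.
  have -> : wexp c * Z = (wexp c - 1) * Z + Z by rewrite mulrBl mul1r subrK.
  by rewrite -[LHS]/(_ w + Z w) h ?add0r// wk.
have : (wdeg (E - wexp c)) w = Z w.
  rewrite -hw -hD -[RHS]/(_ w - ((E - wexp c) * Y) w) hYk ?subr0//.
  by rewrite wk.
rewrite -[(E - wexp c - f) w]/((E - wexp c) w - f w).
rewrite /wdeg wk -[f w]/(k.+1%:R^-1 * whom k.+1 Z w) /whom wk eqxx => <-.
by rewrite mulKf ?subrr// pnatr_eq0.
Qed.

(** The logarithmic derivative of the product is that of [wexp a], carried across [wexp b] by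
    [wexp_conj], plus that of [wexp b]. Both are series of brackets, so [wexp_of_logderiv]
    applies. *)
Lemma bch a b : L a -> L b ->
  exists2 c, L c & wideal m.+1 (wexp a * wexp b - wexp c).
Proof.
move=> La Lb; have [h1 _ _ hB _] := hL.
have [a1 b1] := (h1 _ La, h1 _ Lb).
pose u := wphi a (wdeg a); have Lu : L u by apply: Lphi => //; exact: Lwdeg.
pose Y := u - wphi b (wad u b) + wphi b (wdeg b).
apply: (@wexp_of_logderiv _ Y).
- have -> : wexp a * wexp b - 1 = (wexp a - 1) * wexp b + (wexp b - 1).
    by rewrite mulrBl mul1r addrA subrK.
  apply: widealD; last exact: wexp_approx1.
  by rewrite -[X in wideal X _]addn0; apply: widealM => //; exact: wexp_approx1.
- apply: LD; last by apply: Lphi => //; exact: Lwdeg.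
  by apply: LB => //; apply: Lphi => //; exact: hB.
- have hd := derivation_wdeg R W; have [_ hM _] := hd.
  rewrite hM !(deriv_wexp hd)// -/u -!mulrA -mulrDr; congr (_ * _).
  by rewrite (wexp_conj _ b1) -mulrDr.
Qed.

End BCH.

(** * The free nilpotent group *)

Section TruncatedGroup.
Variables (R : realType) (V : normedVectType R) (m : nat).
Hypothesis m_gt0 : (0 < m)%N.
Local Notation ser := (wser R 'Hom(V, R^o)).
Implicit Types (a b c g h : ser).

Definition wtrunc a : ser := fun w => if (size w <= m)%N then a w else 0.

Lemma wtruncP a b : (wtrunc a = wtrunc b) <-> wideal m.+1 (a - b).
Proof.
split=> [ab w|ab].
  rewrite ltnS => wm; rewrite -[LHS]/(a w - b w).
  have : wtrunc a w = wtrunc b w by rewrite ab.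
  by rewrite /wtrunc wm => ->; rewrite subrr.
apply/funext => w; rewrite /wtrunc; case: ifPn => // wm.
by apply/eqP; rewrite -subr_eq0; apply/eqP; exact: (ab w wm).
Qed.

Lemma wtruncK a : wtrunc (wtrunc a) = wtrunc a.
Proof. by apply/funext => w; rewrite /wtrunc; case: (_ <= _)%N. Qed.

Lemma wtrunc_approx a : wideal m.+1 (wtrunc a - a).
Proof. by apply/wtruncP; exact: wtruncK. Qed.

Lemma wtruncD a b : wtrunc (a + b) = wtrunc a + wtrunc b.
Proof.
apply/funext => w; rewrite -[RHS]/(wtrunc a w + wtrunc b w) /wtrunc.
by case: ifP => // _; rewrite addr0.
Qed.

Lemma wtruncZ (t : R) a : wtrunc (t *: a) = t *: wtrunc a.
Proof.
apply/funext => w; rewrite -[RHS]/(t * wtrunc a w) /wtrunc.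
by case: ifP => // _; rewrite mulr0.
Qed.

Lemma wtruncB a b : wtrunc (a - b) = wtrunc a - wtrunc b.
Proof. by rewrite wtruncD -scaleN1r wtruncZ scaleN1r. Qed.

Lemma wtrunc_sum n (F : nat -> ser) :
  wtrunc (\sum_(i < n) F i) = \sum_(i < n) wtrunc (F i).
Proof.
elim: n => [|n ih]; last by rewrite !big_ord_recr/= wtruncD ih.
by rewrite !big_ord0; apply/funext => w; rewrite /wtrunc; case: ifP.
Qed.

Lemma wtruncMl a b : wtrunc (wtrunc a * b) = wtrunc (a * b).
Proof.
apply/wtruncP; rewrite -mulrBl -[m.+1]addn0.
by apply: widealM => //; exact: wtrunc_approx.
Qed.

Lemma wtruncMr a b : wtrunc (a * wtrunc b) = wtrunc (a * b).
Proof.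
apply/wtruncP; rewrite -mulrBr -[m.+1]add0n.
by apply: widealM => //; exact: wtrunc_approx.
Qed.

Lemma tmul_wtrunc a b : tmul m a b = wtrunc (a * b).
Proof. by apply/funext => w; rewrite /tmul /wtrunc; case: ifP. Qed.

Lemma wtrunc1 : wtrunc 1 = 1.
Proof.
by apply/funext => w; rewrite /wtrunc; case: ifPn => // wm; rewrite wone_cons//; lia.
Qed.

Lemma tpow_wtrunc a k : tpow m a k = wtrunc (a ^+ k).
Proof.
elim: k => [|k ih]; first by rewrite expr0 wtrunc1.
by rewrite /tpow iterS -/(tpow m a k) ih tmul_wtrunc wtruncMr exprS.
Qed.

Lemma texp_wtrunc a : wideal 1 a -> texp m a = wtrunc (wexp a).
Proof.
move=> a1; transitivity (wtrunc (\sum_(k < m.+1) expterm a k)).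
  rewrite wtrunc_sum /texp; apply: (@eq_bigr ser) => k _.
  by rewrite wtruncZ tpow_wtrunc.
apply/wtruncP; rewrite -opprB; apply: widealN.
exact: isum_approx (adapted_exp a1).
Qed.

(** With u = 1 - g, the product of 1 - u and the geometric sum telescopes to 1 - u^(m+1), and
    u^(m+1) has order at least m+1. *)
Lemma tinv_wtrunc g : wideal 1 (g - 1) ->
  wtrunc (tinv m g) = tinv m g /\ wtrunc (g * tinv m g) = 1.
Proof.
move=> g1; pose u : ser := 1 - g.
have -> : tinv m g = wtrunc (\sum_(k < m.+1) u ^+ k).
  rewrite wtrunc_sum /tinv; apply: (@eq_bigr ser) => k _.
  by rewrite -tpow_wtrunc.
rewrite wtruncK; split => //; rewrite wtruncMr -wtrunc1; apply/wtruncP.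
have -> : g = 1 - u by rewrite /u opprB addrC subrK.
rewrite -(opprB u) mulNr -subrX1 opprB addrAC subrr add0r.
by apply: widealN; apply: wideal_exp; rewrite /u -opprB; exact: widealN.
Qed.

Local Notation L := (@free_nilpotent_lie R V m).
Local Notation G := (@free_nilpotent_group R V m).

Lemma tbracket_wtrunc a b : tbracket m a b = wtrunc (wad b a).
Proof. by rewrite /tbracket !tmul_wtrunc /wad wtruncB. Qed.

Lemma trunc_tensor_wtrunc a : trunc_tensor m a -> wtrunc a = a.
Proof.
move=> [am _]; apply/funext => w; rewrite /wtrunc; case: leqP => // wm.
by rewrite am.
Qed.

Lemma trunc_tensor_lincomb (t : R) a b :
  trunc_tensor m a -> trunc_tensor m b -> trunc_tensor m (t *: a + b).
Proof.
move=> [am al] [bm bl]; split=> [w wm|u w f g s].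
  by rewrite -[LHS]/(t * a w + b w) am// bm// mulr0 addr0.
have E x : (t *: a + b) x = (t * a x + b x : R) by [].
rewrite !E al bl.
have H (x1 x2 y1 y2 : R) : t * (s * x1 + x2) + (s * y1 + y2) =
  s * (t * x1 + y1) + (t * x2 + y2) by ring.
exact: H.
Qed.

Lemma trunc_tensorM a b :
  trunc_tensor m a -> trunc_tensor m b -> trunc_tensor m (tmul m a b).
Proof.
move=> [am al] [bm bl]; split=> [w wm|u w f g s].
  by rewrite /tmul leqNgt wm.
rewrite /tmul !size_cat/=; case: ifP => _; last by rewrite mulr0 addr0.
rewrite mulr_sumr -big_split/=; apply: eq_bigr => i _.
have H (x y1 y2 : R) : x * (s * y1 + y2) = s * (x * y1) + x * y2 by ring.
have H' (x y1 y2 : R) : (s * y1 + y2) * x = s * (y1 * x) + y2 * x by ring.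
(* The cut at [i] leaves the distinguished slot in the right factor when [i] is at most [size u],
   and in the left factor otherwise. *)
rewrite !take_cat !drop_cat; case: ifP => iu; first by rewrite bl; exact: H.
have [->|] := posnP (i - size u); first by rewrite !take0 !drop0 (bl [::]); exact: H.
by case: (i - size u)%N => // j _ /=; rewrite al; exact: H'.
Qed.

Lemma lie_trunc_tensor : lie_subalgebra m (@trunc_tensor R V m).
Proof.
split=> //.
- by split=> [//|u w f g s]; rewrite -[RHS]/(s * 0 + 0) mulr0 addr0.
- exact: trunc_tensor_lincomb.
- move=> a b ha hb.
  have -> : tbracket m a b = -1 *: (tmul m b a : ser) + (tmul m a b : ser).
    by rewrite scaleN1r addrC.
  by apply: trunc_tensor_lincomb; exact: trunc_tensorM.
Qed.

Lemma trunc_tensor_tvec (v : V) : trunc_tensor m (tvec v).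
Proof.
split=> [[|f [|]]//=|u w f g s]; first by move: m_gt0; lia.
case: u => [|f' [|]]//=; rewrite ?mulr0 ?addr0//.
case: w => [|]//=; last by rewrite mulr0 addr0.
by rewrite add_lfunE scale_lfunE.
Qed.

(** [trunc_tensor m] is itself one of the subalgebras intersected, which gives the first clause; the
    others are inherited by intersections. *)
Lemma lie_fnl : lie_subalgebra m L.
Proof.
split.
- by move=> a /(_ (trunc_tensor m)); apply; split;
    [exact: lie_trunc_tensor|move=> _ [v _ <-]; exact: trunc_tensor_tvec].
- by move=> M [[_ M0 _ _] _].
- by move=> t a b la lb M hM; have [[_ _ h _] _] := hM; apply: h; [exact: la|exact: lb].
- by move=> a b la lb M hM; have [[_ _ _ h] _] := hM; apply: h; [exact: la|exact: lb].
Qed.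

Lemma fnl_tvec (v : V) : L (tvec v).
Proof. by move=> M [_]; apply; exists v. Qed.

Lemma fnl_ind (M : set ser) : lie_subalgebra m M -> (forall v, M (tvec v)) -> L `<=` M.
Proof. by move=> hM hv a; apply; split => // _ [v _ <-]. Qed.

Lemma fnl_wtrunc a : L a -> wtrunc a = a.
Proof. by have [h _ _ _] := lie_fnl; move/h; exact: trunc_tensor_wtrunc. Qed.

Lemma fnl_wideal a : L a -> wideal 1 a.
Proof.
move: a; suff h : L `<=` [set a | trunc_tensor m a /\ wideal 1 (a : ser)].
  by move=> a /h[].
apply: fnl_ind => [|v]; last first.
  by split; [exact: trunc_tensor_tvec|case].
have [_ h0 hD hM] := lie_trunc_tensor.
split=> //=.
- by move=> a [].
- by move=> t a b [ta a1] [tb b1]; split; [exact: hD|apply: widealD => //; exact: widealZ].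
- move=> a b [ta a1] [tb b1]; split; first exact: hM.
  rewrite tbracket_wtrunc => w w1; rewrite /wtrunc; case: ifP => // _.
  by apply: (@widealB _ _ 1) w1; rewrite -(addn0 1%N); exact: widealM.
Qed.

Lemma whom_wtrunc k a : whom k (wtrunc a) = if (k <= m)%N then whom k a else 0.
Proof.
apply/funext => w; rewrite /whom /wtrunc; case: (leqP k m) => km.
  by case: eqP => // ->; rewrite km.
by case: eqP => // ->; rewrite leqNgt km.
Qed.

Lemma whomB k a b : whom k (a - b) = whom k a - whom k b.
Proof.
apply/funext => w; rewrite -[RHS]/(whom k a w - whom k b w) /whom.
by case: ifP => //; rewrite subr0.
Qed.

(** The elements all of whose components lie in the Lie algebra form a subalgebra containing [V],
    because a component of a bracket is a sum of brackets of components. *)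
Lemma fnl_whom k a : L a -> L (whom k a).
Proof.
move: a; suff h : L `<=` [set a | L a /\ forall k, L (whom k a)].
  by move=> a /h[_]; exact.
have [h1 h0 hD hM] := lie_fnl; apply: fnl_ind => [|v]; last first.
  split=> [|j]; first exact: fnl_tvec.
  have -> : whom j (tvec v) = if j == 1%N then tvec v else 0.
    apply/funext => w; rewrite /whom; case: (j =P 1%N) => [->|j1].
      by case: w => [|f [|]].
    by case: ifP => // /eqP wj; case: w wj => [|f [|]]//= jj; case: j1.
  by case: ifP => _ //; exact: fnl_tvec.
split=> /=.
- by move=> a [/h1].
- by split=> // j; have -> : whom j (0 : ser) = 0
    by apply/funext => w; rewrite /whom; case: ifP.
- move=> t a b [la ha] [lb hb]; split; first exact: hD.
  move=> j; have -> : whom j (t *: (a : ser) + (b : ser)) = t *: whom j a + whom j b.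
    apply/funext => w; rewrite -[RHS]/(t * whom j a w + whom j b w) /whom.
    by case: ifP => // _; rewrite mulr0 addr0.
  exact: hD.
- move=> a b [la ha] [lb hb]; split; first exact: hM.
  move=> j; rewrite tbracket_wtrunc whom_wtrunc; case: ifP => // jm.
  have -> : whom j (wad b a) =
      \sum_(i < j.+1) (tbracket m (whom i a) (whom (j - i)%N b) : ser).
    (* Reversing the second sum makes the same two components meet in both orders, which produces a
       bracket for each [i]. *)
    rewrite /wad whomB !whom_mul [X in _ - X](reindex_inj rev_ord_inj)/= -sumrB.
    apply: eq_bigr => -[i/=]; rewrite ltnS => ij _.
    rewrite subSS subKn// tbracket_wtrunc; apply/funext => w.
    rewrite /wtrunc; case: leqP => // wm.
    (* The truncation inside [tbracket] is harmless: such products live in degree [j <= m] and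
       vanish on longer words. *)
    have hh (p q : nat) (x y : ser) : (p + q = j)%N -> (whom p x * whom q y) w = 0.
      move=> pq; rewrite wmulrE big1// => -[l/=]; rewrite ltnS => lw _.
      rewrite /whom size_takel// size_drop.
      case: eqP => [lp|_]; last by rewrite mul0r.
      case: eqP => [lq|_]; last by rewrite mulr0.
      by move: wm; rewrite -(subnKC lw) lq lp pq ltnNge jm.
    rewrite /wad -[LHS]/((whom i a * whom (j - i)%N b) w - (whom (j - i)%N b * whom i a) w).
    by rewrite !hh ?subrr// ?subnK// subnKC.
  elim/big_ind : _ => // [x y lx ly|i _]; last exact: hM.
  by rewrite -[x]scale1r; exact: hD.
Qed.

(** The truncated Lie algebra enlarged by all series of order above [m]; in this form it is an
    algebra of untruncated series to which [bch] applies. *)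
Definition fnl_ext := [set a : ser | L (wtrunc a)].

Lemma graded_fnl_ext : graded_lie m fnl_ext.
Proof.
have [h1 h0 hD hM] := lie_fnl; split.
- move=> a /fnl_wideal a1 w w1; rewrite -(a1 w w1) /wtrunc ifT//.
  by move: w1; rewrite ltnS leqn0 => /eqP ->.
- move=> a am; rewrite /fnl_ext/=; have -> : wtrunc a = wtrunc 0.
    by apply/wtruncP; rewrite subr0.
  by have -> : wtrunc 0 = 0 by apply/funext => w; rewrite /wtrunc; case: ifP.
- by move=> t a b la lb; rewrite /fnl_ext/= wtruncD wtruncZ; exact: hD.
- move=> a b la lb; rewrite /fnl_ext/=.
  have -> : wtrunc (wad a b) = tbracket m (wtrunc b) (wtrunc a).
    by rewrite tbracket_wtrunc /wad !wtruncB !wtruncMl !wtruncMr.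
  exact: hM.
- move=> k a la; rewrite /fnl_ext/=.
  have -> : wtrunc (whom k a) = whom k (wtrunc a).
    by apply/funext => w; rewrite /wtrunc /whom; case: ifP; case: ifP.
  exact: fnl_whom.
Qed.

Lemma wexp_wtrunc a b : wideal 1 a -> wideal 1 b -> wtrunc a = wtrunc b ->
  wtrunc (wexp a) = wtrunc (wexp b).
Proof.
move=> a1 b1 /wtruncP ab; apply/wtruncP.
have -> : wexp a - wexp b = (wexp (b + (a - b)) - wexp b - (a - b)) + (a - b).
  by rewrite subrK [b + _]addrC subrK.
apply: widealD => //.
by apply: wideal_le (wexp_add_approx (ltn0Sn m) b1 ab).
Qed.

Lemma fng_texp a : L a -> G (texp m a). Proof. by exists a. Qed.

Lemma fng_wtrunc g : G g -> wtrunc g = g.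
Proof. by move=> [a /fnl_wideal la <-]; rewrite texp_wtrunc// wtruncK. Qed.

Lemma fng1 : G tone.
Proof.
have [_ L0 _ _] := lie_fnl; exists 0 => //.
rewrite texp_wtrunc; last exact: wideal0.
by rewrite wexp0 wtrunc1.
Qed.

Lemma fngM g h : G g -> G h -> G (tmul m g h).
Proof.
move=> [a la <-] [b lb <-]; have [a1 b1] := (fnl_wideal la, fnl_wideal lb).
have [||c lc habc] := bch graded_fnl_ext (a := a) (b := b).
- by rewrite /fnl_ext/= fnl_wtrunc.
- by rewrite /fnl_ext/= fnl_wtrunc.
exists (wtrunc c) => //.
have [h1 _ _ _ _] := graded_fnl_ext; have c1 := h1 _ lc.
rewrite tmul_wtrunc !texp_wtrunc ?wtruncMl ?wtruncMr//; last exact: fnl_wideal.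
by rewrite (@wexp_wtrunc _ c)// ?wtruncK//; [exact/esym/wtruncP|exact: fnl_wideal].
Qed.

Lemma tmulA g h k : tmul m g (tmul m h k) = tmul m (tmul m g h) k.
Proof. by rewrite !tmul_wtrunc wtruncMl wtruncMr mulrA. Qed.

Lemma tmul1 g : G g -> tmul m tone g = g.
Proof. by move=> /fng_wtrunc hg; rewrite tmul_wtrunc mul1r. Qed.

Lemma tmulr1 g : G g -> tmul m g tone = g.
Proof. by move=> /fng_wtrunc hg; rewrite tmul_wtrunc mulr1. Qed.

Lemma tinv_texp a : L a -> tinv m (texp m a) = texp m (- a).
Proof.
move=> /fnl_wideal a1.
have g1 : wideal 1 ((texp m a : ser) - (1 : ser)).
  rewrite texp_wtrunc// -wtrunc1 -wtruncB => w w1; rewrite /wtrunc.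
  by case: ifP => // _; exact: wexp_approx1.
have [ht hi] := tinv_wtrunc g1.
have hi1 : wtrunc (wexp a * tinv m (texp m a)) = 1.
  by rewrite -wtruncMl -texp_wtrunc.
rewrite -[LHS]ht [RHS]texp_wtrunc; last exact: widealN.
transitivity (wtrunc (wexp (- a) * (wexp a * tinv m (texp m a)))).
  by rewrite mulrA wexpNl// mul1r.
by rewrite -wtruncMr hi1 mulr1.
Qed.

Lemma fnlN a : L a -> L (- a).
Proof.
have [_ L0 hD _] := lie_fnl => la.
by rewrite -[- a]/(- (a : ser)) -scaleN1r -[_ *: _]addr0; exact: hD.
Qed.

Lemma fngV g : G g -> G (tinv m g).
Proof. by move=> [a la <-]; rewrite tinv_texp//; apply: fng_texp; exact: fnlN. Qed.

Lemma tmulVg g : G g -> tmul m (tinv m g) g = tone.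
Proof.
move=> [a la <-]; have a1 := fnl_wideal la.
rewrite tinv_texp// tmul_wtrunc !texp_wtrunc//; last exact: widealN.
by rewrite wtruncMl wtruncMr wexpNl// wtrunc1.
Qed.

Lemma tmulgV g : G g -> tmul m g (tinv m g) = tone.
Proof.
move=> [a la <-]; have a1 := fnl_wideal la.
rewrite tinv_texp// tmul_wtrunc !texp_wtrunc//; last exact: widealN.
by rewrite wtruncMl wtruncMr wexpNr// wtrunc1.
Qed.

Lemma tinv_uniq g h : G g -> G h -> tmul m g h = tone -> h = tinv m g.
Proof.
move=> Gg Gh gh; rewrite -(tmul1 Gh) -(tmulVg Gg) -tmulA gh tmulr1//.
exact: fngV.
Qed.

Lemma tinvK g : G g -> tinv m (tinv m g) = g.
Proof. by move=> Gg; apply/esym/tinv_uniq; rewrite ?tmulVg//; exact: fngV. Qed.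

Lemma tinv1 : tinv m (tone : tens V) = tone.
Proof. by apply/esym/tinv_uniq; rewrite ?tmul1//; exact: fng1. Qed.

Lemma tinvM g h : G g -> G h -> tinv m (tmul m g h) = tmul m (tinv m h) (tinv m g).
Proof.
move=> Gg Gh; have [Gg' Gh'] := (fngV Gg, fngV Gh).
apply/esym/tinv_uniq; [exact: fngM|exact: fngM|].
by rewrite tmulA -(tmulA g) tmulgV// tmulr1// tmulgV.
Qed.

End TruncatedGroup.

(** * The left-invariant distance and the one-parameter subgroups *)

Section HomogeneousNorm.
Variables (R : realType) (V : normedVectType R) (m : nat) (N : tens V -> R).
Hypothesis m_gt0 : (0 < m)%N.
Hypothesis hN : homogeneous_norm m N.
Local Notation ser := (wser R 'Hom(V, R^o)).
Local Notation G := (@free_nilpotent_group R V m).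
Implicit Types g h k : tens V.

Lemma hnorm_ge0 g : G g -> 0 <= N g. Proof. by have [h _ _ _ _] := hN; exact: h. Qed.

Lemma hnorm1 : N tone = 0.
Proof. by have [_ h _ _ _] := hN; apply/h => //; exact: fng1. Qed.

Lemma fng_div g h : G g -> G h -> G (tmul m (tinv m g) h).
Proof. by move=> Gg Gh; apply: fngM => //; exact: fngV. Qed.

Lemma gdist_ge0 g h : G g -> G h -> 0 <= gdist m N g h.
Proof. by move=> Gg Gh; apply: hnorm_ge0; exact: fng_div. Qed.

Lemma gdistC g h : G g -> G h -> gdist m N g h = gdist m N h g.
Proof.
move=> Gg Gh; have [_ _ _ _ hV] := hN; have Gg' := fngV m_gt0 Gg.
by rewrite /gdist -[LHS]hV ?tinvM ?tinvK//; exact: fng_div.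
Qed.

Lemma gdist_triangle g h k : G g -> G h -> G k ->
  gdist m N g k <= gdist m N g h + gdist m N h k.
Proof.
move=> Gg Gh Gk; have [_ _ _ hM _] := hN.
have -> : gdist m N g k = N (tmul m (tmul m (tinv m g) h) (tmul m (tinv m h) k)).
  rewrite /gdist tmulA -(tmulA _ (tinv m g)) tmulgV// tmulr1//; exact: fngV.
by apply: hM; exact: fng_div.
Qed.

Lemma gdist_tone g : G g -> gdist m N g tone = N g.
Proof.
move=> Gg; have [_ _ _ _ hV] := hN.
by rewrite /gdist tmulr1 ?hV//; exact: fngV.
Qed.

(** The norm is the distance to the neutral element, so this is the reverse triangle inequality. *)
Lemma hnorm_lip g h : G g -> G h -> `|N g - N h| <= gdist m N g h.
Proof.
move=> Gg Gh; have G1 := fng1 V m_gt0.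
rewrite -!gdist_tone// ler_norml; apply/andP; split.
  rewrite lerNl opprB lerBlDr [gdist m N g h]gdistC//.
  exact: gdist_triangle.
by rewrite lerBlDr; exact: gdist_triangle.
Qed.

Section Line.
Variable v : V.

Definition line (c : R) : tens V := texp m (c *: (tvec v : ser)).

Let hv : wideal 1 (tvec v : ser). Proof. by case. Qed.

Lemma line_wtrunc c : line c = wtrunc m (wexp (c *: (tvec v : ser))).
Proof. by rewrite /line texp_wtrunc//; exact: widealZ. Qed.

Lemma fng_line c : G (line c).
Proof.
apply: fng_texp; have [_ L0 hD _] := lie_fnl V m_gt0.
by rewrite -[_ *: _]addr0; apply: hD => //; exact: fnl_tvec.
Qed.

Lemma lineD a b : tmul m (line a) (line b) = line (a + b).
Proof. by rewrite tmul_wtrunc !line_wtrunc wtruncMl wtruncMr wexpD. Qed.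

Lemma line0 : line 0 = tone.
Proof. by rewrite line_wtrunc scale0r wexp0 wtrunc1. Qed.

Lemma tinv_line a : tinv m (line a) = line (- a).
Proof.
apply/esym/tinv_uniq; rewrite ?lineD ?subrr ?line0//; exact: fng_line.
Qed.

(** Dilation by [c] is multiplicative and multiplies [tvec v] by [c], so it commutes with the
    exponential series. Homogeneity of the norm thereby applies along the line. *)
Lemma line_dilation c : line c = dilation c (line 1).
Proof.
have dM (a b : ser) : (dilation c ((a : ser) * (b : ser)) : ser) =
    (dilation c a : ser) * (dilation c b : ser).
  apply/funext => w; rewrite /dilation !wmulrE mulr_sumr.
  apply: eq_bigr => -[i/=]; rewrite ltnS => iw _.
  rewrite /dilation size_takel// size_drop -{1}(subnKC iw) exprD.
  by rewrite mulrACA.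
have dv : (dilation c (tvec v) : ser) = c *: (tvec v : ser).
  apply/funext => w; rewrite -[RHS]/(c * tvec v w) /dilation.
  by case: w => [|f [|f0 w]]; rewrite /= ?expr1 ?mulr0 ?mulr0.
have dX (n : nat) : (dilation c ((tvec v : ser) ^+ n) : ser) = (c *: (tvec v : ser)) ^+ n.
  elim: n => [|n ih]; last by rewrite !exprS dM dv ih.
  apply/funext => w; rewrite !expr0 /dilation; case: w => [|f w].
    by rewrite expr0 mul1r.
  by rewrite wone_cons// mulr0.
rewrite !line_wtrunc; apply/funext => w; rewrite /dilation /wtrunc.
case: ifP => _; last by rewrite mulr0.
rewrite /wexp /isum mulr_sumr; apply: eq_bigr => k _.
have sE (t : R) (a : ser) : (t *: a) w = t * a w by [].
by rewrite /expterm scale1r -dX !sE /dilation mulrCA.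
Qed.

Definition line_norm := N (line 1).

Lemma hnorm_line c : N (line c) = `|c| * line_norm.
Proof.
by have [_ _ h _ _] := hN; rewrite line_dilation h//; exact: fng_line.
Qed.

Lemma gdist_line a b : gdist m N (line a) (line b) = `|b - a| * line_norm.
Proof. by rewrite /gdist tinv_line lineD hnorm_line addrC. Qed.

Lemma line_norm_gt0 : v <> 0 -> 0 < line_norm.
Proof.
move=> v0; rewrite lt_neqAle hnorm_ge0 ?andbT; last exact: fng_line.
have [_ h _ _ _] := hN; apply/eqP => /esym /(h _ (fng_line 1)) h1.
apply: v0.
have hf (f : 'Hom(V, R^o)) : f v = 0.
  have <- : line 1 [:: f] = 0 by rewrite h1.
  rewrite line_wtrunc scale1r /wtrunc /= ifT//.
  rewrite /wexp /isum !big_ord_recl big_ord0 addr0/= /expterm expr0 expr1.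
  have sE (t : R) (a : ser) w : (t *: a) w = t * a w by [].
  by rewrite !sE wone_cons// mulr0 add0r invr1 mul1r.
rewrite (coord_vbasis (memvf v)) big1// => i _.
have := hf (linfun (coord (vbasis {:V}) i)); rewrite lfunE/= => ->.
by rewrite scale0r.
Qed.

Lemma increment_line (f : R -> R) s t :
  increment m (line \o f) s t = line (f t - f s).
Proof. by rewrite /increment /= tinv_line lineD addrC. Qed.

(** By [line_dilation] each coordinate of the line is a monomial in the parameter, hence
    continuous. *)
Lemma line_path (f : R -> R) : f 0 = 0 -> {within `[0, 1], continuous f} ->
  group_path m (line \o f).
Proof.
move=> f0 fc; split=> [t _|w|].
- exact: fng_line.
- have -> : (fun t => (line \o f) t w : R) = (fun t => f t ^+ size w * line 1 w).
    by apply/funext => t; rewrite /= line_dilation.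
  have Pc : continuous (fun y : R => y ^+ size w * line 1 w).
    move=> y; apply: cvgM; [exact: exprn_continuous|exact: cvg_cst].
  by move=> t; apply: (continuous_comp (fc t) (Pc (f t))).
- by rewrite /= f0 line0.
Qed.

End Line.

Lemma increment_tone s t : increment m (fun=> tone : tens V) s t = tone.
Proof. by rewrite /increment tinv1// tmul1//; exact: fng1. Qed.

Lemma fng_increment x s t : group_path m x -> 0 <= s <= 1 -> 0 <= t <= 1 ->
  G (increment m x s t).
Proof. by move=> [hG _ _] hs ht; apply: fng_div; apply: hG; rewrite in_itv. Qed.

End HomogeneousNorm.

(** * A criterion for non-separability *)

Section Separability.
Variables (R : realType) (T : Type).

(** Cantor's diagonal argument: under injectivity, [e0] takes at each code [F e] the value opposite
    to [e (F e)], which is contradictory for [e = e0]. *)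
Lemma no_injective_bool_seq (F : (nat -> bool) -> nat) : ~ injective F.
Proof.
move=> Finj; pose e0 n := `[< forall e, F e = n -> e n = false >].
have [h|h] := pselect (e0 (F e0)).
  by have := h; rewrite {1}/e0 => /asboolP/(_ e0 erefl); rewrite h.
by apply: (h); apply/asboolP => e /Finj ->; exact/negbTE/negP.
Qed.

(** Separation is phrased through a common neighbour [y] in [E] because [d] is an arbitrary
    extended-valued function, for which no triangle inequality is assumed. Choosing a neighbour in
    [D] for each [e] would inject bit sequences into a countable set. *)
Lemma not_separable (E : set T) (d : T -> T -> \bar R) (x : (nat -> bool) -> T)
    (delta : R) : 0 < delta -> (forall e, E (x e)) ->
  (forall e e' y, e <> e' -> E y -> (d (x e) y < delta%:E)%E ->
    (d (x e') y < delta%:E)%E -> False) ->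
  ~ separable E d.
Proof.
move=> delta0 xE sep [D [cD DE hD]].
have ch e : {y | D y /\ (d (x e) y < delta%:E)%E}.
  by apply: cid; have [y] := hD _ (xE e) _ delta0; exists y.
have /countable_injP[g ginj] := cD.
apply: (@no_injective_bool_seq (fun e => g (sval (ch e)))) => e e' ee'.
apply: contrapT => /sep hne.
have [Dy dy] := svalP (ch e); have [Dy' dy'] := svalP (ch e').
have yy : sval (ch e) = sval (ch e') by apply: ginj => //; exact: mem_set.
by apply: (hne (sval (ch e))) => //; [exact: DE|rewrite yy].
Qed.

End Separability.

(** * Bounds extracted from, and sufficient for, finiteness of the two distances *)

Section Variation.
Variables (R : realType) (V : normedVectType R) (m : nat) (N : tens V -> R) (p : R).
Hypothesis m_gt0 : (0 < m)%N.
Hypothesis hN : homogeneous_norm m N.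
Hypothesis p_ge1 : 1 <= p.
Local Notation G := (@free_nilpotent_group R V m).
Local Notation inc := (increment m).

Let p_gt0 : 0 < p. Proof. exact: lt_le_trans p_ge1. Qed.

Lemma partition_node (D : seq R) (t := nth 1 (0 :: D)) : itv_partition 0 1 D ->
  t (size D) = 1 /\ forall i, (i < size D)%N -> [/\ 0 <= t i, t i < t i.+1 & t i.+1 <= 1].
Proof.
move=> [sD /eqP lD]; have t1 : t (size D) = 1 by rewrite /t -last_nth lD.
have hlt i j : (i < j)%N -> (j <= size D)%N -> t i < t j.
  move=> ij jD; have sD' : sorted <%O (0 :: D) by [].
  by apply: (sorted_ltn_nth lt_trans 1 sD'); rewrite // inE /= ltnS// (leq_trans (ltnW ij)).
split=> // i iD; split; last 2 first.
- exact: hlt.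
- by move: iD; rewrite leq_eqVlt => /orP[/eqP ->|iD]; rewrite -?t1// ltW// hlt.
by case: i iD => [//|i iD]; rewrite -[0]/(t 0) ltW// hlt// ltnW.
Qed.

Lemma le_powRV (S e : R) : 0 <= S -> 0 <= e -> S `^ p^-1 <= e -> S <= e `^ p.
Proof.
move=> S0 e0 Se; rewrite -[S]powRr1// -(mulVf (lt0r_neq0 p_gt0)) powRrM.
by apply: ge0_ler_powR; rewrite ?nnegrE ?powR_ge0//; exact: ltW.
Qed.

(** The uniform partition into [M] intervals is one of those over which the supremum is taken. *)
Lemma dpvar_uniform x y (e : R) (M : nat) : (0 < M)%N ->
  group_path m x -> group_path m y -> 0 <= e ->
  (dpvar m N p x y < e%:E)%E ->
  \sum_(0 <= i < M) gdist m N (inc x (i%:R / M%:R) (i.+1%:R / M%:R))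
     (inc y (i%:R / M%:R) (i.+1%:R / M%:R)) `^ p <= e `^ p.
Proof.
move=> M0 hx hy e0 he.
have M0' : 0 < M%:R :> R by rewrite ltr0n.
pose t (i : nat) : R := i%:R / M%:R.
have t0 : t 0 = 0 by rewrite /t mul0r.
pose D := [seq t i | i <- iota 1 M].
have sD : size D = M by rewrite size_map size_iota.
have tD i : (i <= M)%N -> nth 1 (0 :: D) i = t i.
  move=> iM; rewrite -t0 -[t 0 :: D]/[seq t i | i <- iota 0 M.+1].
  by rewrite (nth_map 0%N) ?size_iota ?ltnS// nth_iota ?add0n.
apply: le_powRV => //; first by apply: sumr_ge0 => i _; exact: powR_ge0.
rewrite -lee_fin; apply: le_trans (ltW he); apply: ereal_sup_ubound.
exists D.
  split; last by rewrite (last_nth 1) sD tD// /t divff// lt0r_neq0.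
  have: sorted <%O [seq t i | i <- iota 0 M.+1].
    rewrite sorted_map; apply: (@sub_sorted _ ltn) (iota_ltn_sorted 0 M.+1).
    by move=> i j ij /=; rewrite /t ltr_pM2r ?invr_gt0// ltr_nat.
  by rewrite /= t0.
rewrite /= sD; congr ((_ `^ _)%:E); apply: eq_big_nat => i /andP[_ iM].
have E1 := tD i (ltnW iM); have E2 := tD i.+1 iM.
by move: E1 E2; rewrite /t /= => -> ->.
Qed.

(** The sum over any partition telescopes to at most [F 1 - F 0]; the first condition on [F] ensures
    that this number is nonnegative. *)
Lemma dpvar_fin x (F : R -> R) : (forall t, 0 <= t <= 1 -> F t <= F 1) ->
  (forall s t, 0 <= s -> s < t -> t <= 1 ->
    gdist m N (inc x s t) tone `^ p <= F t - F s) ->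
  (dpvar m N p x (fun=> tone) < +oo)%E.
Proof.
move=> F1 hx; apply: (@le_lt_trans _ _ (((F 1 - F 0) `^ p^-1)%:E)); last exact: ltry.
apply: ge_ereal_sup => _ [D hD <-] /=; rewrite lee_fin.
have := partition_node hD; set t := nth 1 (0 :: D); move=> [tD ht].
apply: ge0_ler_powR.
- by rewrite invr_ge0 ltW.
- by rewrite nnegrE sumr_ge0// => i _; exact: powR_ge0.
- by rewrite nnegrE subr_ge0 F1// lexx ler01.
have -> : F 1 - F 0 = F (t (size D)) - F (t 0%N) by rewrite tD.
rewrite -(telescope_sumr (fun i => F (t i)))//.
apply: ler_sum_nat => i /andP[_ iD].
have [h0 h1 h2] := ht i iD.
by rewrite increment_tone// hx.
Qed.

Lemma domega_lt (omega : R * R -> R) x y (e : R) :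
  group_path m x -> group_path m y -> (domega m N omega p x y < e%:E)%E ->
  forall s t, 0 <= s -> s < t -> t <= 1 -> 0 <= omega (s, t) ->
  gdist m N (inc x s t) (inc y s t) <= e * omega (s, t) `^ p^-1.
Proof.
move=> hx hy he s t s0 st t1 o0; set d := gdist _ _ _ _; set r := _ `^ _.
have d0 : 0 <= d.
  by apply: gdist_ge0 => //; apply: fng_increment => //; apply/andP; split => //; lra.
have : (d%:E / r%:E <= e%:E)%E.
  apply: le_trans (ltW he); apply: ereal_sup_ubound.
  by exists (s, t).
(* For [r = 0] the quotient is +oo unless [d = 0], so a finite bound forces [d = 0]. *)
have [r0|r0] := eqVneq r 0.
  rewrite r0 inve0; have [->|dn0] := eqVneq d 0; first by rewrite mulr0.
  by rewrite gt0_muley ?lte_fin ?lt_neqAle ?d0 ?andbT ?[0 == _]eq_sym.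
have r_gt0 : 0 < r by rewrite lt_neqAle eq_sym r0 powR_ge0.
by rewrite inver (negbTE r0) -EFinM lee_fin ler_pdivrMr.
Qed.

Lemma domega_fin (omega : R * R -> R) x (e : R) : (forall s t, 0 <= s -> s < t -> t <= 1 ->
    0 <= gdist m N (inc x s t) tone <= e * omega (s, t) `^ p^-1) ->
  (domega m N omega p x (fun=> tone) < +oo)%E.
Proof.
(* The absolute value is needed since [e] carries no sign, and the quotient is 0 at pairs where
   [omega] vanishes. *)
move=> hx; apply: (@le_lt_trans _ _ (`|e|%:E)); last exact: ltry.
apply: ge_ereal_sup => _ [[s t] /= [s0 st t1] <-].
rewrite increment_tone//; have := hx s t s0 st t1.
set d := gdist _ _ _ _; set r := _ `^ _ => /andP[d0 der].
have [r0|r0] := eqVneq r 0.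
  have -> : d = 0 by apply/eqP; rewrite eq_le d0 andbT (le_trans der)// r0 mulr0.
  by rewrite r0 mul0e lee_fin.
have r_gt0 : 0 < r by rewrite lt_neqAle eq_sym r0 powR_ge0.
rewrite inver (negbTE r0) -EFinM lee_fin ler_pdivrMr// (le_trans der)//.
by rewrite ler_wpM2r ?ler_norm// ltW.
Qed.

End Variation.

(** * Separated families of functions of finite p-variation *)

Section ScalarTools.
Variable R : realType.

Lemma bounded_mono_cvg (u : R ^nat) (B : R) :
  (forall n, u n <= u n.+1) -> (forall n, u n <= B) -> cvgn u.
Proof.
move=> hu hB; apply: nondecreasing_is_cvgn; first exact/nondecreasing_seqP.
by exists B => _ [n _ <-].
Qed.

Lemma exists_invexp2_lt (eps : R) : 0 < eps -> exists n, 2 ^- n < eps.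
Proof.
move=> eps0; exists (Num.bound eps^-1).
rewrite -[ltRHS]invrK ltf_pV2 ?posrE ?invr_gt0// ?exprn_gt0//.
have e1 : 0 <= eps^-1 by rewrite invr_ge0 ltW.
by apply: lt_trans (archi_boundP e1) _; rewrite -natrX ltr_nat ltn_expl.
Qed.

Lemma within_continuousP (f : R -> R) :
  (forall t, 0 <= t <= 1 -> forall e, 0 < e -> exists2 d, 0 < d &
     forall s, 0 <= s <= 1 -> `|s - t| < d -> `|f s - f t| < e) ->
  {within `[0, 1], continuous f}.
Proof.
move=> h; apply/subspace_continuousP => t; rewrite /= in_itv/= => t01.
apply/cvgrPdist_lt => e e0; have [d d0 hd] := h t t01 e e0.
rewrite near_withinE; exists d => //= s st; rewrite in_itv/= => s01.
by rewrite distrC; apply: hd => //; rewrite distrC.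
Qed.

Lemma first_difference (e e' : nat -> bool) : e <> e' ->
  exists k, e k != e' k /\ forall j, (j < k)%N -> e j = e' j.
Proof.
move=> ne; have ex : exists k, e k != e' k.
  apply: contrapT => h; apply: ne; apply/funext => k; apply: contrapT => hk.
  by apply: h; exists k; exact/eqP.
case: (ex_minnP ex) => k hk kmin; exists k; split=> // j jk.
by apply/eqP; apply: contraTT jk => /kmin; rewrite -leqNgt.
Qed.

End ScalarTools.

(** * Cantor functions with prescribed base-4 digits *)

Section Cantor.
Variable R : realType.
Implicit Types (e : nat -> bool) (s t : R).

Definition shift_seq e : nat -> bool := fun k => e k.+1.

(** The distribution function of (d + x) / 4, where the digit d is [e 0] or [e 0 + 2] with
    probability 1/2 each and x is independent, distributed according to the shifted sequence. The
    recursion starts from the unit mass at 1, whose distribution function is the least on [0, 1], so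
    the approximations increase with [n]. *)
Fixpoint cantor_approx (n : nat) e t : R :=
  if n is n'.+1 then
    (cantor_approx n' (shift_seq e) (4 * t - (e 0%N)%:R) +
     cantor_approx n' (shift_seq e) (4 * t - 2 - (e 0%N)%:R)) / 2
  else (1 <= t)%R%:R.

Lemma bool01 (b : bool) : 0 <= (b%:R : R) <= 1.
Proof. by case: b; rewrite ?lexx ler01. Qed.

Lemma cantor_approx_mono n e s t : s <= t -> cantor_approx n e s <= cantor_approx n e t.
Proof.
elim: n e s t => [|n ih] e s t st /=.
  by rewrite ler_nat; case: (leP 1 s) => // s1; rewrite (le_trans s1 st).
by rewrite ler_pM2r ?invr_gt0// lerD// ih//; lra.
Qed.

Lemma cantor_approx_le0 n e t : t <= 0 -> cantor_approx n e t = 0.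
Proof.
elim: n e t => [|n ih] e t t0 /=; first by rewrite leNgt (le_lt_trans t0)// ltr01.
by have /andP[e0 e1] := bool01 (e 0%N); rewrite !ih ?addr0 ?mul0r//; lra.
Qed.

Lemma cantor_approx_ge1 n e t : 1 <= t -> cantor_approx n e t = 1.
Proof.
elim: n e t => [|n ih] e t t0 /=; first by rewrite t0.
by have /andP[e0 e1] := bool01 (e 0%N); rewrite !ih; lra.
Qed.

Lemma cantor_approx01 n e t : 0 <= cantor_approx n e t <= 1.
Proof.
have [t0|t0] := leP t 0; first by rewrite cantor_approx_le0// lexx ler01.
apply/andP; split; first by rewrite -(cantor_approx_le0 n e (lexx 0)) cantor_approx_mono// ltW.
have [t1|t1] := leP t 1; last by rewrite cantor_approx_ge1// ltW.
by rewrite -(cantor_approx_ge1 n e (lexx 1)) cantor_approx_mono.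
Qed.

Lemma cantor_approx_incr n e t : cantor_approx n e t <= cantor_approx n.+1 e t.
Proof.
elim: n e t => [|n ih] e t; last first.
  rewrite [cantor_approx n.+2 e t]/= [cantor_approx n.+1 e t]/=.
  by rewrite ler_pM2r ?invr_gt0// lerD// ih.
case: (leP 1 t) => [t1|t1]; first by rewrite [X in _ <= X]cantor_approx_ge1//= t1.
have -> : cantor_approx 0 e t = 0 by rewrite /= leNgt t1.
by have /andP[] := cantor_approx01 1 e t.
Qed.

Definition cantor e t : R := limn (fun n => cantor_approx n e t).

Lemma cantor_cvg e t : cantor_approx n e t @[n --> \oo] --> cantor e t.
Proof.
apply: (@bounded_mono_cvg R (fun n => cantor_approx n e t) 1) => n.
  exact: cantor_approx_incr.
by have /andP[] := cantor_approx01 n e t.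
Qed.

Lemma cantorE e t : cantor e t =
  (cantor (shift_seq e) (4 * t - (e 0%N)%:R) +
   cantor (shift_seq e) (4 * t - 2 - (e 0%N)%:R)) / 2.
Proof.
have h : cantor_approx n.+1 e t @[n --> \oo] --> cantor e t.
  by have := @cantor_cvg e t; rewrite -(cvg_shiftS (fun n => cantor_approx n e t)).
apply: (cvg_unique _ h) => //=.
by apply: cvgM; [apply: cvgD; exact: cantor_cvg|exact: cvg_cst].
Qed.

Lemma cantor_le0 e t : t <= 0 -> cantor e t = 0.
Proof.
move=> t0; rewrite /cantor.
by under eq_fun do rewrite cantor_approx_le0//; exact: lim_cst.
Qed.

Lemma cantor_ge1 e t : 1 <= t -> cantor e t = 1.
Proof.
move=> t1; rewrite /cantor.
by under eq_fun do rewrite cantor_approx_ge1//; exact: lim_cst.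
Qed.

Lemma cantor_mono e s t : s <= t -> cantor e s <= cantor e t.
Proof.
move=> st; apply: ler_lim; [exact: cantor_cvg|exact: cantor_cvg|].
by apply: nearW => n; exact: cantor_approx_mono.
Qed.

Lemma cantor01 e t : 0 <= cantor e t <= 1.
Proof.
have [t0|t0] := leP t 0; first by rewrite cantor_le0// lexx ler01.
apply/andP; split; first by rewrite -(cantor_le0 e (lexx 0)) cantor_mono// ltW.
have [t1|t1] := leP t 1; last by rewrite cantor_ge1// ltW.
by rewrite -(cantor_ge1 e (lexx 1)) cantor_mono.
Qed.

(** Each step of the functional equation multiplies lengths by 4 and halves the values, which
    amounts to Hoelder exponent 1/2. *)
Lemma cantor_osc n e s t : s <= t -> t - s <= 4 ^- n ->
  cantor e t - cantor e s <= 2 ^- n.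
Proof.
elim: n e s t => [|n ih] e s t st.
  have /andP[_ ?] := cantor01 e t; have /andP[? _] := cantor01 e s.
  by move=> _; rewrite expr0 invr1; lra.
move=> h; rewrite (cantorE e t) (cantorE e s).
set s' := 4 * s - _; set t' := 4 * t - _ .
have hs : 4 * s - 2 - (e 0%N)%:R = s' - 2 by rewrite /s'; ring.
have ht : 4 * t - 2 - (e 0%N)%:R = t' - 2 by rewrite /t'; ring.
rewrite hs ht.
have st' : s' <= t' by rewrite /s' /t'; lra.
have hst : t' - s' <= 4 ^- n.
  have -> : t' - s' = 4 * (t - s) by rewrite /t' /s'; ring.
  by move: h; rewrite exprS invfM -ler_pdivlMl// mulrC.
have hst1 : t' - s' <= 1.
  by apply: (le_trans hst); rewrite invf_le1 ?exprn_gt0// exprn_ege1// ler1n.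
rewrite exprS invfM.
(* As [t' - s' <= 1], the interval cannot meet the interiors of both [0, 1] and [2, 3], so one of
   the two copies is constant on it. *)
have [t2|t2] := leP t' 2.
  rewrite (@cantor_le0 _ (t' - 2)); last by lra.
  rewrite (@cantor_le0 _ (s' - 2)); last by lra.
  by have := ih (shift_seq e) s' t' st' hst; lra.
rewrite (@cantor_ge1 _ t'); last by lra.
rewrite (@cantor_ge1 _ s'); last by lra.
have := ih (shift_seq e) (s' - 2) (t' - 2); lra.
Qed.

Lemma cantor_continuous e : {within `[0, 1], continuous (cantor e)}.
Proof.
apply: within_continuousP => t _ eps eps0.
have [n hn] := exists_invexp2_lt eps0.
exists (4 ^- n) => [|s _ st]; first by rewrite invr_gt0 exprn_gt0.
apply: le_lt_trans hn.
have [ts|ts] := leP t s.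
  rewrite ger0_norm ?subr_ge0 ?cantor_mono//; apply: cantor_osc => //.
  by rewrite ltW// -(ger0_norm (x := s - t))// subr_ge0.
rewrite distrC ger0_norm ?subr_ge0 ?cantor_mono//; last exact: ltW.
apply: cantor_osc; first exact: ltW.
by rewrite ltW// -(ger0_norm (x := t - s)) ?subr_ge0 1?distrC// ltW.
Qed.

Definition mesh_var (M : nat) (g : R -> R) : R :=
  \sum_(0 <= i < M) `|g (i.+1%:R / M%:R) - g (i%:R / M%:R)|.

Lemma cantor_quarters e : [/\ cantor e (0%:R / 4%:R) = 0,
  cantor e (1%:R / 4%:R) = (~~ e 0%N)%:R / 2, cantor e (2%:R / 4%:R) = 1 / 2,
  cantor e (3%:R / 4%:R) = (1 + (~~ e 0%N)%:R) / 2 & cantor e (4%:R / 4%:R) = 1].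
Proof.
split; rewrite ?(@cantor_le0 _ (0 / 4)) ?(@cantor_ge1 _ (4 / 4)); try lra.
all: rewrite cantorE; case: (e 0%N) => /=.
all: repeat (rewrite cantor_le0; last by lra) || (rewrite cantor_ge1; last by lra); lra.
Qed.

(** While the leading bits agree, the difference consists of two copies at half height, on two
    quarters of [0, 1], of the difference for the shifted sequences, so its variation is not lost.
    At the first differing bit the two measures charge complementary quarters. *)
Lemma cantor_separation e e' k : e k != e' k -> (forall j, (j < k)%N -> e j = e' j) ->
  1 <= mesh_var (4 ^ k.+1) (fun t => cantor e t - cantor e' t).
Proof.
elim: k e e' => [|k ih] e e' hk hj.
  have [q0 q1 q2 q3 q4] := cantor_quarters e.
  have [q0' q1' q2' q3' q4'] := cantor_quarters e'.
  rewrite /mesh_var expn1 !big_nat_recl// big_geq// q0 q1 q2 q3 q4 q0' q1' q2' q3' q4'.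
  (* Over the first two quarters the difference moves by 1/2 and back, which already gives variation
     1. *)
  have hsum (x1 x2 x3 x4 : R) : 1 <= x2 - x1 \/ 1 <= x1 - x2 ->
      1 <= `|x1| + (`|x2| + (`|x3| + (`|x4| + 0))).
    have := ler_norm x1; have := ler_norm x2.
    have := ler_norm (- x1); have := ler_norm (- x2); rewrite !normrN.
    by have := normr_ge0 x3; have := normr_ge0 x4; move=> + + + + + + [|]; lra.
  apply: hsum; case: (e 0%N) (e' 0%N) hk => -[]//= _; [left|right]; lra.
set h := fun t => cantor (shift_seq e) t - cantor (shift_seq e') t.
set M := (4 ^ k.+1)%N.
have M0 : (0 < M)%N by rewrite expn_gt0.
have M0' : M%:R != 0 :> R by rewrite pnatr_eq0 -lt0n.
have e0 : e 0%N = e' 0%N by exact: hj.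
have {}ih : 1 <= mesh_var M h.
  by apply: ih => [//|j jk]; exact: hj.
have h_out t : t <= 0 \/ 1 <= t -> h t = 0.
  by move=> [t0|t1]; rewrite /h; [rewrite !cantor_le0|rewrite !cantor_ge1]; rewrite ?subrr.
set g := fun t => _ - _.
have gE t : g t = (h (4 * t - (e 0%N)%:R) + h (4 * t - 2 - (e 0%N)%:R)) / 2.
  rewrite /g (cantorE e) (cantorE e') -e0 /h; lra.
pose D i := `|g (i.+1%:R / (4 * M)%:R) - g (i%:R / (4 * M)%:R)|.
have Mp : 0 < M%:R :> R by rewrite ltr0n.
have hfrac (i b : nat) : (i + b * M)%:R / (4 * M)%:R = (b%:R + i%:R / M%:R) / 4 :> R.
  have -> : (4 * M)%:R = M%:R * 4 :> R by rewrite natrM mulrC.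
  by rewrite natrD natrM invfM mulrA mulrDl mulfK// addrC.
have blk (b : nat) : \sum_(b * M <= i < b.+1 * M) D i =
    \sum_(0 <= i < M) `|g ((b%:R + i.+1%:R / M%:R) / 4) - g ((b%:R + i%:R / M%:R) / 4)|.
  rewrite -[X in \sum_(X <= _ < _) _](add0n (b * M)%N) big_addn mulSn addnK.
  apply: eq_bigr => i _; rewrite /D; congr (`|g _ - g _|).
    by rewrite -addSn; exact: hfrac.
  exact: hfrac.
have D0 i j : 0 <= \sum_(i <= l < j) D l by apply: sumr_ge0 => l _; exact: normr_ge0.
(* [h] vanishes outside the open unit interval, so quarter number [e 0] sees only the first copy of
   [h] and quarter [e 0 + 2] only the second. Each contributes half of the variation, on either side
   of the middle index [2 * M]. *)
have hblk1 : \sum_(e 0%N * M <= i < (e 0%N).+1 * M) D i = mesh_var M h / 2.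
  rewrite blk /mesh_var mulr_suml; apply: eq_big_nat => i /andP[_ iM].
  have hi : 0 <= i%:R / M%:R :> R by rewrite divr_ge0.
  have hi1 : i.+1%:R / M%:R <= 1 :> R by rewrite ler_pdivrMr ?ltr0n// mul1r ler_nat.
  have hii : i%:R / M%:R <= i.+1%:R / M%:R :> R by rewrite ler_pM2r ?invr_gt0 ?ltr0n// ler_nat.
  rewrite !gE.
  have E (x : R) : 4 * (((e 0%N)%:R + x) / 4) - (e 0%N)%:R = x by field.
  have E2 (x : R) : 4 * (((e 0%N)%:R + x) / 4) - 2 - (e 0%N)%:R = x - 2 by field.
  rewrite !E !E2 (h_out (_ - 2)); last by left; lra.
  rewrite (h_out (i%:R / _ - 2)); last by left; lra.
  by rewrite !addr0 -mulrBl normrM (ger0_norm (x := 2^-1))// invr_ge0.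
have hblk2 : \sum_(((e 0%N).+2 * M)%N <= i < ((e 0%N).+3 * M)%N) D i = mesh_var M h / 2.
  rewrite blk /mesh_var mulr_suml; apply: eq_big_nat => i /andP[_ iM].
  have hi : 0 <= i%:R / M%:R :> R by rewrite divr_ge0.
  have hii : i%:R / M%:R <= i.+1%:R / M%:R :> R by rewrite ler_pM2r ?invr_gt0 ?ltr0n// ler_nat.
  rewrite !gE.
  have eN : (e 0%N).+2%:R = (e 0%N)%:R + 2 :> R by rewrite -natrD addn2.
  have E (x : R) : 4 * (((e 0%N).+2%:R + x) / 4) - (e 0%N)%:R = x + 2 by rewrite eN; field.
  have E2 (x : R) : 4 * (((e 0%N).+2%:R + x) / 4) - 2 - (e 0%N)%:R = x by rewrite eN; field.
  rewrite !E !E2 (h_out (_ + 2)); last by right; lra.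
  rewrite (h_out (i%:R / _ + 2)); last by right; lra.
  by rewrite !add0r -mulrBl normrM (ger0_norm (x := 2^-1))// invr_ge0.
have -> : mesh_var (4 ^ k.+2) g = \sum_(0 <= i < 4 * M) D i by rewrite expnS.
rewrite (big_cat_nat (n := (2 * M)%N))//=; last by rewrite leq_mul2r orbT.
have l1 : mesh_var M h / 2 <= \sum_(0 <= i < 2 * M) D i.
  rewrite -hblk1; case: (e 0%N) => /=.
    by rewrite [leRHS](big_cat_nat (n := M))//= ?mul1n ?lerDr// leq_pmull.
  by rewrite mul0n mul1n [leRHS](big_cat_nat (n := M))//= ?lerDl// leq_pmull.
have l2 : mesh_var M h / 2 <= \sum_(2 * M <= i < 4 * M) D i.
  rewrite -hblk2; case: (e 0%N) => /=.
    by rewrite [leRHS](big_cat_nat (n := (3 * M)%N))//= ?lerDr// leq_mul2r orbT.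
  by rewrite [leRHS](big_cat_nat (n := (3 * M)%N))//= ?lerDl// leq_mul2r orbT.
lra.
Qed.

End Cantor.

(** * Lacunary series of distances to the integers *)

Section Lacunary.
Variables (R : realType).
Implicit Types (e : nat -> bool) (s t : R).

Definition dist_int t : R := Num.min (t - (Num.floor t)%:~R) ((Num.floor t)%:~R + 1 - t).

Lemma dist_int_le t (z : int) : dist_int t <= `|t - z%:~R|.
Proof.
have h1 : (Num.floor t)%:~R <= t by exact: floor_le_tmp.
have h2 : t < (Num.floor t)%:~R + 1 by have := floorD1_gt t; rewrite intrD.
rewrite /dist_int ge_min; have [zt|zt] := leP z (Num.floor t).
  have zt' : z%:~R <= (Num.floor t)%:~R :> R by rewrite ler_int.
  by rewrite ger0_norm; [apply/orP; left; lra|lra].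
have zt' : (Num.floor t)%:~R + 1 <= z%:~R :> R by rewrite -intrD1 ler_int lezD1.
by rewrite ler0_norm; [apply/orP; right; lra|lra].
Qed.

Lemma dist_int_attained t : exists z : int, dist_int t = `|t - z%:~R|.
Proof.
have h1 : (Num.floor t)%:~R <= t by exact: floor_le_tmp.
have h2 : t < (Num.floor t)%:~R + 1 by have := floorD1_gt t; rewrite intrD.
rewrite /dist_int; case: (leP (t - (Num.floor t)%:~R)) => h.
  by exists (Num.floor t); rewrite ger0_norm//; lra.
by exists (Num.floor t + 1); rewrite intrD distrC ger0_norm//; lra.
Qed.

Lemma dist_int_ge0 t : 0 <= dist_int t.
Proof. by have [z ->] := dist_int_attained t. Qed.

Lemma dist_int_le_half t : dist_int t <= 2^-1.
Proof. by rewrite /dist_int ge_min; case: (leP (t - (Num.floor t)%:~R) (2^-1)) => //= h; lra. Qed.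

Lemma dist_int_lip s t : `|dist_int s - dist_int t| <= `|s - t|.
Proof.
have h x y : dist_int x - dist_int y <= `|x - y|.
  have [z ->] := dist_int_attained y; rewrite lerBlDr.
  by apply: le_trans (dist_int_le x z) _; rewrite -[x - z%:~R](subrKA y) ler_normD.
by rewrite ler_norml h andbT lerNl opprB distrC.
Qed.

Lemma dist_int_nat (n : nat) : dist_int n%:R = 0.
Proof.
apply/eqP; rewrite eq_le dist_int_ge0 andbT.
by have := dist_int_le n%:R n; rewrite subrr normr0.
Qed.

Lemma dist_int_half (n : nat) : dist_int (n%:R + 2^-1) = 2^-1.
Proof.
apply/eqP; rewrite eq_le dist_int_le_half/=; have [z ->] := dist_int_attained (n%:R + 2^-1).
have [zn|zn] := leP z n.
  have zn' : z%:~R <= n%:R :> R by rewrite -[n%:R]/(n%:~R) ler_int.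
  by rewrite ger0_norm; lra.
have zn' : n%:R + 1 <= z%:~R :> R by rewrite -[n%:R]/(n%:~R) -intrD1 ler_int lezD1.
by rewrite ler0_norm; lra.
Qed.

Lemma dist_int_halves (i : nat) : dist_int (i%:R / 2) = (odd i)%:R / 2.
Proof.
rewrite -[in LHS](odd_double_half i) -muln2 natrD natrM mulrDl mulfK// addrC.
by case: (odd i); rewrite ?mul0r ?addr0 ?dist_int_nat// mul1r dist_int_half.
Qed.

Variable a : R.
Hypotheses (a_gt : 1 < 2 * a) (a_lt1 : a < 1).

(** The partial sums of sum_k e_k a^k dist(2^k t, Z), written by their functional equation so that
    inductions proceed by doubling [t]. *)
Fixpoint lacunary_approx (n : nat) e t : R :=
  if n is n'.+1 then
    (e 0%N)%:R * dist_int t + a * lacunary_approx n' (shift_seq e) (2 * t)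
  else 0.

Let a_gt0 : 0 < a. Proof. by move: a_gt; lra. Qed.

Lemma lacunary_approx_incr n e t : lacunary_approx n e t <= lacunary_approx n.+1 e t.
Proof.
elim: n e t => [|n ih] e t.
  by rewrite /= mulr0 addr0 mulr_ge0// dist_int_ge0.
rewrite [lacunary_approx n.+2 e t]/= [lacunary_approx n.+1 e t]/=.
by rewrite lerD2l ler_pM2l// ih.
Qed.

Lemma lacunary_approx_ge0 n e t : 0 <= lacunary_approx n e t.
Proof.
by elim: n => // n ih; apply: le_trans ih _; exact: lacunary_approx_incr.
Qed.

(** The solution of B = 1 + a B, an upper bound that the recursion preserves. *)
Definition lacunary_bound := (1 - a)^-1.

Lemma lacunary_approx_le n e t : lacunary_approx n e t <= lacunary_bound.
Proof.
have b1 : lacunary_bound * (1 - a) = 1 by rewrite /lacunary_bound mulVf// lt0r_neq0// subr_gt0.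
have b0 : 0 <= lacunary_bound by rewrite invr_ge0 subr_ge0 ltW.
elim: n e t => [//|n ih] e t /=.
have /andP[e0 e1] := bool01 R (e 0%N).
have h1 : (e 0%N)%:R * dist_int t <= 1.
  have := dist_int_le_half t; have := dist_int_ge0 t; move: e0 e1; nra.
have := ih (shift_seq e) (2 * t); move: a_gt0 b1; nra.
Qed.

Lemma lacunary_approx_nat n e (i : nat) : lacunary_approx n e i%:R = 0.
Proof.
elim: n e i => [//|n ih] e i /=; rewrite dist_int_nat mulr0 add0r.
by rewrite -natrM ih mulr0.
Qed.

Definition lacunary e t : R := limn (fun n => lacunary_approx n e t).

Lemma lacunary_cvg e t : lacunary_approx n e t @[n --> \oo] --> lacunary e t.
Proof.
apply: (@bounded_mono_cvg R (fun n => lacunary_approx n e t) lacunary_bound) => n.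
  exact: lacunary_approx_incr.
exact: lacunary_approx_le.
Qed.

Lemma lacunaryE e t : lacunary e t =
  (e 0%N)%:R * dist_int t + a * lacunary (shift_seq e) (2 * t).
Proof.
have h : lacunary_approx n.+1 e t @[n --> \oo] --> lacunary e t.
  by have := @lacunary_cvg e t; rewrite -(cvg_shiftS (fun n => lacunary_approx n e t)).
apply: (cvg_unique _ h) => //=; apply: cvgD; first exact: cvg_cst.
by apply: cvgM; [exact: cvg_cst|exact: lacunary_cvg].
Qed.

Lemma lacunary_nat e (i : nat) : lacunary e i%:R = 0.
Proof.
rewrite /lacunary; under eq_fun do rewrite lacunary_approx_nat.
exact: lim_cst.
Qed.

Lemma lacunary_ge0 e t : 0 <= lacunary e t.
Proof.
apply: limr_ge; first exact: lacunary_cvg.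
by apply: nearW => n; exact: lacunary_approx_ge0.
Qed.

Lemma lacunary_le e t : lacunary e t <= lacunary_bound.
Proof.
apply: limr_le; first exact: lacunary_cvg.
by apply: nearW => n; exact: lacunary_approx_le.
Qed.

Lemma lacunary_step e s t : `|lacunary e t - lacunary e s| <=
  `|t - s| + a * `|lacunary (shift_seq e) (2 * t) - lacunary (shift_seq e) (2 * s)|.
Proof.
rewrite (lacunaryE e t) (lacunaryE e s) opprD addrACA -!mulrBr.
apply: le_trans (ler_normD _ _) _; rewrite !normrM (gtr0_norm a_gt0) lerD2r.
apply: le_trans (dist_int_lip t s).
by case: (e 0%N); rewrite ?normr1 ?mul1r// normr0 mul0r.
Qed.

(** Terms before [k] cancel because the bits agree, terms after [k] vanish at multiples of 2^-(k+1),
    and the k-th term passes between 0 and a^k / 2 on each mesh interval. *)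
Lemma lacunary_separation e e' k (i : nat) : e k != e' k ->
  (forall j, (j < k)%N -> e j = e' j) ->
  `|(lacunary e (i.+1%:R / (2 ^ k.+1)%:R) - lacunary e' (i.+1%:R / (2 ^ k.+1)%:R)) -
    (lacunary e (i%:R / (2 ^ k.+1)%:R) - lacunary e' (i%:R / (2 ^ k.+1)%:R))| = a ^+ k / 2.
Proof.
elim: k e e' => [|k ih] e e' hk hj.
  have E d (j : nat) : lacunary d (j%:R / (2 ^ 1)%:R) = (d 0%N)%:R * ((odd j)%:R / 2).
    by rewrite lacunaryE expn1 dist_int_halves [2 * _]mulrC divfK// lacunary_nat mulr0 addr0.
  rewrite !E expr0 /=.
  by case: (e 0%N) (e' 0%N) hk => -[]//= _; case: (odd i) => /=;
    rewrite ?mul0r ?mul1r ?subr0 ?sub0r ?opprK ?normrN ger0_norm//; lra.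
have E d (j : nat) : lacunary d (j%:R / (2 ^ k.+2)%:R) =
    (d 0%N)%:R * dist_int (j%:R / (2 ^ k.+2)%:R)
     + a * lacunary (shift_seq d) (j%:R / (2 ^ k.+1)%:R).
  rewrite lacunaryE expnS; congr (_ + a * lacunary _ _).
  by rewrite natrM invfM mulrCA mulVKf.
have C (x u1 v1 y u2 v2 : R) : (x + a * u1 - (x + a * v1)) - (y + a * u2 - (y + a * v2)) =
  a * ((u1 - v1) - (u2 - v2)) by ring.
rewrite !E -(hj 0%N)// C normrM (gtr0_norm a_gt0) ih ?exprS ?mulrA//.
by move=> j jk; exact: hj.
Qed.

Variable al : R.
Hypotheses (al_gt0 : 0 < al) (al_a : a = 2 `^ (- al)).

Definition hoelder_const := (lacunary_bound + (2 * a - 1)^-1) / a.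

(* The correction term - c (t - s) with c (2 a - 1) = 1 absorbs the linear
   error made by the functional equation at each doubling of t - s. *)
Lemma lacunary_hoelder_aux n e s t : 2 ^- n <= t - s -> t - s <= 1 ->
  `|lacunary e t - lacunary e s| <=
    hoelder_const * (t - s) `^ al - (2 * a - 1)^-1 * (t - s).
Proof.
set c := (2 * a - 1)^-1.
have c1 : c * (2 * a - 1) = 1 by rewrite mulVf// lt0r_neq0// subr_gt0.
have c0 : 0 < c by rewrite invr_gt0 subr_gt0.
have b0 : 0 < lacunary_bound by rewrite invr_gt0 subr_gt0.
have K0 : 0 < hoelder_const by rewrite divr_gt0// addr_gt0.
have Ka : hoelder_const * a = lacunary_bound + c by rewrite divfK// lt0r_neq0.
have hbase e' s' t' : 2^-1 <= t' - s' -> t' - s' <= 1 -> `|lacunary e' t' - lacunary e' s'| <=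
    hoelder_const * (t' - s') `^ al - c * (t' - s').
  move=> h2 h1; have ha : a <= (t' - s') `^ al.
    rewrite al_a powRN -powR_inv1// powRAC powR_inv1//.
    apply: ge0_ler_powR => //; first exact: ltW.
      by rewrite nnegrE invr_ge0.
    by rewrite nnegrE (le_trans _ h2)// invr_ge0.
  have hB : `|lacunary e' t' - lacunary e' s'| <= lacunary_bound.
    have := lacunary_ge0 e' t'; have := lacunary_ge0 e' s'.
    have := lacunary_le e' t'; have := lacunary_le e' s'.
    by move=> ? ? ? ?; rewrite ler_norml; lra.
  have : hoelder_const * a <= hoelder_const * (t' - s') `^ al by rewrite ler_pM2l.
  have : c * (t' - s') <= c by rewrite ler_piMr// ltW.
  by rewrite Ka; lra.
elim: n e s t => [|n ih] e s t hn h1.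
all: have [h2|h2] := leP 2^-1 (t - s).
1, 3: exact: hbase.
- by move: hn; rewrite expr0 invr1; lra.
have hn' : 2 ^- n <= 2 * t - 2 * s.
  by move: hn; rewrite exprS invfM -mulrBr ler_pdivrMl.
have h1' : 2 * t - 2 * s <= 1 by lra.
have ts0 : 0 < t - s by apply: lt_le_trans hn; rewrite invr_gt0 exprn_gt0.
apply: le_trans (lacunary_step _ _ _) _.
have := ih (shift_seq e) _ _ hn' h1'.
have -> : (2 * t - 2 * s) `^ al = a^-1 * (t - s) `^ al.
  by rewrite -mulrBr powRM ?ltW// al_a powRN invrK.
rewrite (gtr0_norm ts0).
set D := `|_ - _|; set P := _ `^ al => hD.
have : a * D <= hoelder_const * P - a * c * 2 * (t - s).
  have -> : hoelder_const * P - a * c * 2 * (t - s) = a * (hoelder_const * (a^-1 * P) - c * (2 * t - 2 * s)).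
    by field; rewrite lt0r_neq0.
  by rewrite ler_pM2l.
have E : c * (2 * a - 1) * (t - s) = t - s by rewrite c1 mul1r.
by move: E; rewrite (_ : c * (2 * a - 1) * (t - s) = a * c * 2 * (t - s) - c * (t - s)); [lra|ring].
Qed.

Lemma lacunary_hoelder e s t : s < t -> t - s <= 1 ->
  `|lacunary e t - lacunary e s| <= hoelder_const * (t - s) `^ al.
Proof.
move=> st h1; have ts0 : 0 < t - s by rewrite subr_gt0.
have [n /ltW hn] := exists_invexp2_lt ts0.
apply: le_trans (lacunary_hoelder_aux e hn h1) _.
by rewrite lerBlDr lerDl mulr_ge0 ?invr_ge0 ?ltW// subr_gt0.
Qed.

Lemma hoelder_const_gt0 : 0 < hoelder_const.
Proof. by rewrite divr_gt0// addr_gt0// invr_gt0 subr_gt0. Qed.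

Lemma lacunary_continuous e : {within `[0, 1], continuous (lacunary e)}.
Proof.
apply: within_continuousP => t t01 eps eps0.
pose d := (eps / hoelder_const) `^ al^-1.
have d0 : 0 < d by rewrite powR_gt0// divr_gt0// hoelder_const_gt0.
have key x y : x < y -> y - x <= 1 -> y - x < d ->
    `|lacunary e y - lacunary e x| < eps.
  move=> xy xy1 hd; apply: le_lt_trans (lacunary_hoelder e xy xy1) _.
  rewrite -ltr_pdivlMl ?hoelder_const_gt0// mulrC.
  have -> : eps / hoelder_const = d `^ al.
    by rewrite /d -powRrM mulVf ?lt0r_neq0// powRr1// ltW// divr_gt0// hoelder_const_gt0.
  by apply: gt0_ltr_powR => //; rewrite nnegrE ?subr_ge0; exact: ltW.
exists d => // s s01; move: s01 t01 => /andP[s0 s1] /andP[t0 t1].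
case: (ltgtP s t) => [st|ts|->]; last by rewrite !subrr !normr0.
  rewrite distrC gtr0_norm ?subr_gt0// distrC => h.
  by apply: key => //; lra.
rewrite gtr0_norm ?subr_gt0// => h.
by apply: key => //; lra.
Qed.

End Lacunary.

(** * The separated scalar family for every exponent *)

Section ScalarFamily.
Variables (R : realType) (p : R).
Hypothesis p_ge1 : 1 <= p.

(** [F] bounds partition sums by telescoping: it is the Cantor function itself for p = 1, and linear
    for p > 1 because of the 1/p-Hoelder bound. The mesh [M] depends on the first differing bit,
    whereas [c] is the same for all pairs. *)
Lemma scalar_family : exists2 c : R, 0 < c &
  exists f : (nat -> bool) -> R -> R, [/\ forall e, f e 0 = 0,
    forall e, {within `[0, 1], continuous (f e)},
    forall e, exists2 F : R -> R, (forall t, 0 <= t <= 1 -> F t <= F 1) &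
      forall s t, 0 <= s -> s < t -> t <= 1 -> `|f e t - f e s| `^ p <= F t - F s &
    forall e e', e <> e' -> exists2 M : nat, (0 < M)%N &
      c <= \sum_(0 <= i < M)
        `|(f e (i.+1%:R / M%:R) - f e (i%:R / M%:R)) -
          (f e' (i.+1%:R / M%:R) - f e' (i%:R / M%:R))| `^ p].
Proof.
have [p1|p1] := eqVneq p 1.
  exists 1 => //; exists (@cantor R); split.
  - by move=> e; exact: cantor_le0.
  - exact: cantor_continuous.
  - move=> e; exists (cantor e) => [t /andP[_ t1]|s t s0 st t1].
      exact: cantor_mono.
    rewrite p1 powRr1// ger0_norm ?subr_ge0 ?cantor_mono//; exact: ltW.
  - move=> e e' /first_difference[k [hk hj]]; exists (4 ^ k.+1)%N; first by rewrite expn_gt0.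
    apply: le_trans (cantor_separation R hk hj) _; apply: ler_sum => i _.
    rewrite p1 powRr1//; set x := _ / _; set y := _ / _.
    by rewrite le_eqVlt; apply/orP; left; apply/eqP; congr `|_|; ring.
have {p1}p_gt1 : 1 < p by rewrite lt_neqAle eq_sym p1.
have p0 : 0 < p by exact: lt_trans p_gt1.
pose al := p^-1; pose a : R := 2 `^ (- al).
have al0 : 0 < al by rewrite invr_gt0.
have aE : a * 2 `^ al = 1 by rewrite /a powRN mulVf// lt0r_neq0// powR_gt0.
have al1 : al < 1 by rewrite invf_lt1.
have gt1_pow2 r : 0 < r -> 1 < 2 `^ r :> R.
  move=> r0; have E : 1 `^ r = 1 :> R by rewrite powR1.
  rewrite -[ltLHS]E.
  by apply: gt0_ltr_powR; rewrite ?nnegrE ?ler01 ?ler0n ?ltr1n.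
have h1 : 1 < 2 `^ al :> R by exact: gt1_pow2.
have a0 : 0 < a by exact: powR_gt0.
have a_lt1 : a < 1 by rewrite -aE ltr_pMr.
have a_gt : 1 < 2 * a.
  have -> : 2 * a = 2 `^ (1 - al) by rewrite powRD ?powRr1//; apply/implyP => _; exact: lt0r_neq0.
  by apply: gt1_pow2; rewrite subr_gt0.
pose K := hoelder_const a.
have K0 : 0 < K by exact: hoelder_const_gt0.
(* There are 2^(k+1) mesh intervals with increments a^k / 2, and a^p = 1/2 cancels the number of
   intervals up to a factor 2. *)
exists (2 * 2^-1 `^ p); first by rewrite mulr_gt0// powR_gt0.
exists (lacunary a); split.
- by move=> e; have := lacunary_nat a e 0%N; rewrite mulr0n.
- by move=> e; exact: (lacunary_continuous a_gt a_lt1 al0).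
- move=> e; exists (fun t => K `^ p * t) => [t /andP[_ t1]|s t s0 st t1].
    by rewrite ler_pM2l// powR_gt0.
  have ts : 0 <= t - s by rewrite subr_ge0 ltW.
  have E : (t - s) = ((t - s) `^ al) `^ p by rewrite -powRrM mulVf ?powRr1// lt0r_neq0.
  have K0' : 0 <= K by exact: ltW.
  rewrite -mulrBr [X in _ * X]E -powRM ?powR_ge0//.
  apply: ge0_ler_powR; [exact: ltW|by []| |].
    by apply: mulr_ge0 => //; exact: powR_ge0.
  by apply: (lacunary_hoelder a_gt a_lt1 al0) => //; lra.
- move=> e e' /first_difference[k [hk hj]]; exists (2 ^ k.+1)%N; first by rewrite expn_gt0.
  have ap : a `^ p = 2^-1.
    by rewrite /a -powRrM mulNr mulVf ?lt0r_neq0// powR_inv1.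
  have hterm i : `|lacunary a e (i.+1%:R / (2 ^ k.+1)%:R) - lacunary a e (i%:R / (2 ^ k.+1)%:R)
     - (lacunary a e' (i.+1%:R / (2 ^ k.+1)%:R) - lacunary a e' (i%:R / (2 ^ k.+1)%:R))| `^ p
     = 2^-1 ^+ k * 2^-1 `^ p.
    set x := `|_|; have -> : x = a ^+ k / 2.
      by rewrite -(lacunary_separation a_gt a_lt1 i hk hj) /x; congr `|_|; ring.
    have a0' : 0 <= a by exact: ltW.
    rewrite powRM ?invr_ge0 ?exprn_ge0//; congr (_ * _).
    by rewrite -ap -!powR_mulrn ?powR_ge0// powRAC.
  under eq_bigr do rewrite hterm.
  rewrite big_const_nat subn0 iter_addr_0 -[leRHS]mulr_natl natrX exprS exprVn.
  by rewrite -mulrA mulVKf// expf_neq0.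
Qed.

End ScalarFamily.

(** * Separated families of omega-Hoelder functions *)

Section Windows.
Variables (R : realType) (rho : R -> R -> R) (f : R -> R) (C top v : R).
Hypotheses
  (rho_ge0 : forall s t, 0 <= s -> s < t -> t <= 1 -> 0 <= rho s t)
  (rho_mono : forall s s' t' t, 0 <= s -> s <= s' -> s' < t' -> t' <= t -> t <= 1 ->
     rho s' t' <= rho s t)
  (f_rho : forall s t, 0 <= s -> s < t -> t <= 1 -> `|f t - f s| <= C * rho s t)
  (f_cont : {within `[0, 1], continuous f})
  (f0 : f 0 = 0) (top01 : 0 <= top <= 1) (f_top : f top = v) (v_gt0 : 0 < v).
Implicit Types (e : nat -> bool) (s t : R).

(** The windows are disjoint dyadic intervals of values of [f], not of times; [f] may enter the same
    window many times. *)
Definition window_end (n : nat) : R := v / 2 ^+ n.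

Lemma window_end_gt0 n : 0 < window_end n.
Proof. by rewrite divr_gt0// exprn_gt0. Qed.

Lemma window_endS n : window_end n = 2 * window_end n.+1.
Proof. by rewrite /window_end exprS invfM mulrCA mulVKf. Qed.

Lemma window_end_le i j : (i <= j)%N -> window_end j <= window_end i.
Proof.
move=> ij; rewrite ler_pM2l// lef_pV2 ?posrE ?exprn_gt0//.
by apply: ler_weXn2l => //; rewrite ler1n.
Qed.

(** The distance from [f t] to the complement of the n-th window, hence 1-Lipschitz in [f t]. *)
Definition window_bump n t : R :=
  Num.max 0 (Num.min (f t - window_end n.+1) (window_end n - f t)).

Lemma window_bump_ge0 n t : 0 <= window_bump n t.
Proof. by rewrite le_max lexx. Qed.

Lemma window_bump_gt0 n t :
  (0 < window_bump n t) = (window_end n.+1 < f t < window_end n).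
Proof. by rewrite lt_max ltxx/= lt_min !subr_gt0. Qed.

Lemma window_bump_eq0 n t :
  (window_bump n t == 0) = ~~ (window_end n.+1 < f t < window_end n).
Proof. by rewrite -window_bump_gt0 lt_neqAle window_bump_ge0 andbT eq_sym negbK. Qed.

Lemma window_bump_lip n s t : `|window_bump n t - window_bump n s| <= `|f t - f s|.
Proof.
have h x y : window_bump n x - window_bump n y <= `|f x - f y|.
  rewrite lerBlDr /window_bump; set a := window_end _; set b := window_end _.
  have h1 := ler_norm (f x - f y); have h2 := ler_norm (- (f x - f y)).
  rewrite normrN in h2; have h3 := normr_ge0 (f x - f y).
  set X := `|_| in h1 h2 h3 *.
  rewrite ge_max; apply/andP; split; first by rewrite addr_ge0// le_max lexx.
  rewrite -lerBlDl le_max; apply/orP; right.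
  by rewrite le_min; apply/andP; split; rewrite lerBlDl ge_min; apply/orP; [left|right]; lra.
by rewrite ler_norml h andbT lerNl opprB distrC h.
Qed.

Lemma window_bump_uniq n k t : 0 < window_bump n t -> 0 < window_bump k t -> n = k.
Proof.
rewrite !window_bump_gt0 => /andP[a1 a2] /andP[b1 b2].
have [nk|kn|//] := ltngtP n k.
  by have := window_end_le nk; move=> h; have := lt_le_trans b2 h; rewrite ltNge ltW.
by have := window_end_le kn; move=> h; have := lt_le_trans a2 h; rewrite ltNge ltW.
Qed.

Lemma window_bump_end n k t : f t = window_end k -> window_bump n t = 0.
Proof.
move=> ft; apply/eqP; rewrite window_bump_eq0 ft negb_and -!leNgt.
have [nk|kn] := ltnP n k; first by rewrite window_end_le.
by rewrite (window_end_le kn) orbT.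
Qed.

Lemma f_ivt s t y : 0 <= s -> s <= t -> t <= 1 ->
  Num.min (f s) (f t) <= y <= Num.max (f s) (f t) -> exists2 r, s <= r <= t & f r = y.
Proof.
move=> s0 st t1 hy; have [|r rst fr] := @IVT R f s t y st _ hy.
  apply: continuous_subspaceW f_cont; apply: subset_itv; rewrite bnd_simp; assumption.
by exists r.
Qed.

Lemma window_bump_pos n : exists2 t, 0 < t <= 1 & 0 < window_bump n t.
Proof.
have /andP[t0 t1] := top01.
have h1 := window_end_gt0 n.+1; have h2 := window_endS n.
have h3 : window_end n <= v.
  by have := window_end_le (leq0n n); rewrite {2}/window_end expr0 divr1.
(* The value sought is the midpoint of the n-th window, which lies between [f 0 = 0] and
   [f top = v]. *)
have [|r /andP[r0 rt] fr] := @f_ivt 0 top (3 / 2 * window_end n.+1) (lexx 0) t0 t1.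
  by rewrite f0 f_top (min_l (ltW v_gt0)) (max_r (ltW v_gt0)); apply/andP; split; lra.
exists r; last by rewrite window_bump_gt0 fr; apply/andP; split; lra.
rewrite (le_trans rt t1) andbT lt_neqAle r0 andbT; apply/eqP => r00.
by move: fr; rewrite -r00 f0; lra.
Qed.

(** Their supremum is the Hoelder constant of the bump relative to [rho]. Where [rho] vanishes the
    quotient is 0 by convention, and the increment of the bump vanishes too by [bump_rho]. *)
Definition window_ratios n : set R :=
  [set `|window_bump n st.2 - window_bump n st.1| / rho st.1 st.2 |
    st in [set st : R * R | [/\ 0 <= st.1, st.1 < st.2 & st.2 <= 1]]].

Definition window_slope n : R := sup (window_ratios n).

Lemma bump_rho n s t : 0 <= s -> s < t -> t <= 1 ->
  `|window_bump n t - window_bump n s| <= C * rho s t.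
Proof.
by move=> s0 st t1; apply: le_trans (window_bump_lip n s t) _; exact: f_rho.
Qed.

Lemma has_sup_ratios n : has_sup (window_ratios n).
Proof.
split; first by eexists; exists (0, 1) => //=.
exists `|C| => _ [[s t] /= [s0 st t1] <-].
have r0 := rho_ge0 s0 st t1; have h := bump_rho n s0 st t1.
have [r00|rn0] := eqVneq (rho s t) 0; first by rewrite r00 invr0 mulr0.
have rp : 0 < rho s t by rewrite lt_neqAle eq_sym rn0.
rewrite ler_pdivrMr// (le_trans h)// ler_pM2r//; exact: ler_norm.
Qed.

Lemma bump_le_slope n s t : 0 <= s -> s < t -> t <= 1 ->
  `|window_bump n t - window_bump n s| <= window_slope n * rho s t.
Proof.
move=> s0 st t1; have r0 := rho_ge0 s0 st t1.
have [r00|rn0] := eqVneq (rho s t) 0.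
  by rewrite r00 mulr0; have := bump_rho n s0 st t1; rewrite r00 mulr0.
have rp : 0 < rho s t by rewrite lt_neqAle eq_sym rn0.
rewrite -ler_pdivrMr//; apply: (sup_ubound (has_sup_ratios n).2).
by exists (s, t).
Qed.

Lemma window_slope_gt0 n : 0 < window_slope n.
Proof.
have [t /andP[t0 t1] ht] := window_bump_pos n.
have := bump_le_slope n (lexx 0) t0 t1.
have -> : window_bump n 0 = 0.
  by apply/eqP; rewrite window_bump_eq0 f0 negb_and -leNgt ltW// window_end_gt0.
rewrite subr0 gtr0_norm// => h.
have hp := lt_le_trans ht h; have r0 := rho_ge0 (lexx 0) t0 t1.
by rewrite ltNge; apply/negP => hs; move: hp; rewrite ltNge mulr_le0_ge0.
Qed.

(** The series of the normalized bumps selected by [e]. At most one bump is positive at [t], so the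
    only relevant index is picked by choice and no convergence is involved. *)
Definition window_sum e t : R :=
  if pselect (exists n, 0 < window_bump n t) is left h
  then (e (sval (cid h)))%:R * (window_bump (sval (cid h)) t / window_slope (sval (cid h)))
  else 0.

Lemma window_sumE e n t : 0 < window_bump n t ->
  window_sum e t = (e n)%:R * (window_bump n t / window_slope n).
Proof.
move=> hn; rewrite /window_sum; case: pselect => [h|[]]; last by exists n.
by case: cid => k hk /=; rewrite (window_bump_uniq hk hn).
Qed.

Lemma window_sum_eq0 e t : (forall n, window_bump n t = 0) -> window_sum e t = 0.
Proof.
move=> ht; rewrite /window_sum; case: pselect => // h; exfalso.
by have [n] := h; rewrite ht ltxx.
Qed.

Lemma window_cases t : (exists n, 0 < window_bump n t) \/ (forall n, window_bump n t = 0).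
Proof.
have [h|h] := pselect (exists n, 0 < window_bump n t); [by left|right=> n].
apply/eqP; rewrite eq_le window_bump_ge0 andbT leNgt; apply/negP => hn.
by apply: h; exists n.
Qed.

Lemma window_sum0 e : window_sum e 0 = 0.
Proof.
apply: window_sum_eq0 => n; apply/eqP.
by rewrite window_bump_eq0 f0 negb_and -leNgt ltW// window_end_gt0.
Qed.

Lemma normalized_bump_le n s t : 0 <= s -> s < t -> t <= 1 ->
  `|window_bump n t / window_slope n - window_bump n s / window_slope n| <= rho s t.
Proof.
move=> s0 st t1; have B0 := window_slope_gt0 n.
rewrite -mulrBl normrM (gtr0_norm (x := _^-1)) ?invr_gt0//.
by rewrite ler_pdivrMr// mulrC; exact: bump_le_slope.
Qed.

Lemma window_sum_le e n t x : 0 < window_bump n t ->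
  `|window_bump n t / window_slope n| <= x -> `|window_sum e t| <= x.
Proof.
move=> hn hx; rewrite (window_sumE e hn) normrM; apply: le_trans hx.
by case: (e n); rewrite ?normr1 ?mul1r// normr0 mul0r.
Qed.

(** When [s] and [t] lie in different windows, each value is, up to sign, zero or the full increment
    of its own normalized bump between [s] and [t]; the two bounds add up to the factor 2. *)
Lemma window_sum_rho e s t : 0 <= s -> s < t -> t <= 1 ->
  `|window_sum e t - window_sum e s| <= 2 * rho s t.
Proof.
move=> s0 st t1; have r0 := rho_ge0 s0 st t1.
have hb n := normalized_bump_le n s0 st t1.
have ht n : 0 < window_bump n t -> window_bump n s = 0 -> `|window_sum e t| <= rho s t.
  move=> hn h0; apply: (window_sum_le e hn); have := hb n.
  by rewrite h0 mul0r subr0.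
have hs n : 0 < window_bump n s -> window_bump n t = 0 -> `|window_sum e s| <= rho s t.
  move=> hn h0; apply: (window_sum_le e hn); have := hb n.
  by rewrite h0 mul0r sub0r normrN.
have r2 : rho s t <= 2 * rho s t by lra.
have [[n hn]|hs0] := window_cases s; have [[k hk]|ht0] := window_cases t.
- have [nk|nk] := eqVneq n k.
    subst k; rewrite (window_sumE e hn) (window_sumE e hk) -mulrBr normrM.
    apply: le_trans r2; apply: le_trans (hb n).
    by case: (e n); rewrite ?normr1 ?mul1r// normr0 mul0r.
  have h1 : window_bump n t = 0.
    apply/eqP; rewrite eq_le window_bump_ge0 andbT leNgt; apply/negP => h.
    by move/eqP: nk; apply; exact: window_bump_uniq h hk.
  have h2 : window_bump k s = 0.
    apply/eqP; rewrite eq_le window_bump_ge0 andbT leNgt; apply/negP => h.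
    by move/eqP: nk; apply; exact: window_bump_uniq hn h.
  apply: le_trans (ler_normB _ _) _; have := ht _ hk h2; have := hs _ hn h1; lra.
- by rewrite (window_sum_eq0 e ht0) sub0r normrN; apply: le_trans r2; exact: hs (ht0 n).
- by rewrite (window_sum_eq0 e hs0) subr0; apply: le_trans r2; exact: ht (hs0 k).
- by rewrite !window_sum_eq0// subrr normr0 mulr_ge0.
Qed.

Lemma bool_diff_norm (b b' : bool) (x : R) : b != b' -> `|b%:R * x - b'%:R * x| = `|x|.
Proof. by case: b b' => -[]//= _; rewrite mul1r mul0r ?subr0 ?sub0r ?normrN. Qed.

(* Between a point inside the window and a point outside it, the path crosses
   an end of the window, where all bumps vanish. *)
Lemma window_boundary n s t : 0 <= s -> s <= t -> t <= 1 ->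
  (0 < window_bump n s) != (0 < window_bump n t) ->
  exists2 r, s <= r <= t & forall k, window_bump k r = 0.
Proof.
move=> s0 st t1 hst.
suff [r [hr [fr|fr]]] : exists r, s <= r <= t /\ (f r = window_end n.+1 \/ f r = window_end n).
- by exists r => // k; exact: window_bump_end fr.
- by exists r => // k; exact: window_bump_end fr.
have h y : Num.min (f s) (f t) <= y <= Num.max (f s) (f t) -> exists2 r, s <= r <= t & f r = y.
  exact: f_ivt.
have lohi : window_end n.+1 < window_end n.
  by rewrite (window_endS n); have := window_end_gt0 n.+1; lra.
have [h1|h1] := boolP (Num.min (f s) (f t) <= window_end n.+1 <= Num.max (f s) (f t)).
  by have [r hr fr] := h _ h1; exists r; split=> //; left.
have [h2|h2] := boolP (Num.min (f s) (f t) <= window_end n <= Num.max (f s) (f t)).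
  by have [r hr fr] := h _ h2; exists r; split=> //; right.
exfalso; move: hst h1 h2; rewrite !window_bump_gt0 !ge_min !le_max.
move: (window_end n) (window_end n.+1) (f s) (f t) lohi => hi lo x y lohi.
case: (ltP lo x) => a1; case: (ltP x hi) => a2; case: (ltP lo y) => a3; case: (ltP y hi) => a4 //= _;
  rewrite ?(ltW a1) ?(ltW a2) ?(ltW a3) ?(ltW a4) ?a1 ?a2 ?a3 ?a4 ?orbT ?andbT//=; lra.
Qed.

(** For a differing bit [n], some pair (s, t) realizes more than half of the Hoelder constant of the
    n-th bump. If one of the points is outside window [n], another window may contribute there; that
    point is moved to a boundary point where all bumps vanish, which keeps the increment of the n-th
    bump and does not increase [rho]. *)
Lemma window_sum_separation e e' : e <> e' -> exists s t,
  [/\ 0 <= s, s < t, t <= 1, 0 < rho s t &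
   rho s t / 2 <= `|(window_sum e t - window_sum e s) -
                    (window_sum e' t - window_sum e' s)|].
Proof.
move=> /first_difference[n [hn _]].
have B0 := window_slope_gt0 n.
have B2 : 0 < window_slope n / 2 by rewrite divr_gt0.
have [_ [[s t] /= [s0 st t1] <-] hst] := sup_adherent B2 (has_sup_ratios n).
have {hst} : window_slope n / 2 < `|window_bump n t - window_bump n s| / rho s t.
  by apply: le_lt_trans hst; rewrite -/(window_slope n); lra.
have r0 := rho_ge0 s0 st t1.
have [->|rn0] := eqVneq (rho s t) 0; first by rewrite invr0 mulr0; lra.
have rp : 0 < rho s t by rewrite lt_neqAle eq_sym rn0.
rewrite ltr_pdivlMr// => hst.
have {hst} hst : rho s t / 2 < `|window_bump n t / window_slope n - window_bump n s / window_slope n|.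
  rewrite -mulrBl normrM (gtr0_norm (x := _^-1)) ?invr_gt0// ltr_pdivlMr//.
  by apply: le_lt_trans hst; rewrite le_eqVlt; apply/orP; left; apply/eqP; ring.
have bump0 x : ~~ (0 < window_bump n x) -> window_bump n x = 0.
  by rewrite -leNgt => h; apply/eqP; rewrite eq_le h window_bump_ge0.
have C4 (a b c d : R) : (a - b) - (c - d) = (a - c) - (b - d) by ring.
have [hs|/bump0 hs] := boolP (0 < window_bump n s); have [ht|/bump0 ht] := boolP (0 < window_bump n t).
- exists s, t; split => //; rewrite C4 !(window_sumE _ hs) !(window_sumE _ ht).
  rewrite -!mulrBl -mulrBr !mulrBl bool_diff_norm//.
  exact: ltW.
- have [|r /andP[sr rt] hr] := @window_boundary n s t s0 (ltW st) t1.
    by rewrite hs ht ltxx.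
  have {}sr : s < r.
    by rewrite lt_neqAle sr andbT; apply/eqP => sr'; move: hs; rewrite sr' hr ltxx.
  have r1 := le_trans rt t1.
  have := bump_le_slope n s0 sr r1; rewrite hr sub0r normrN gtr0_norm// => hB.
  exists s, r; split => //.
    rewrite lt_neqAle rho_ge0// andbT; apply/eqP => h0; move: hB; rewrite -h0 mulr0.
    by rewrite leNgt hs.
  rewrite !(window_sum_eq0 _ hr) !sub0r -opprD normrN !(window_sumE _ hs) bool_diff_norm//.
  apply: le_trans (_ : rho s t / 2 <= _); first by rewrite ler_pM2r// rho_mono.
  by move: hst; rewrite ht mul0r sub0r normrN => /ltW.
- have [|r /andP[sr rt] hr] := @window_boundary n s t s0 (ltW st) t1.
    by rewrite hs ht ltxx.
  have {}rt : r < t.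
    by rewrite lt_neqAle rt andbT; apply/eqP => rt'; move: ht; rewrite -rt' hr ltxx.
  have r1 := le_trans s0 sr.
  have := bump_le_slope n r1 rt t1; rewrite hr subr0 gtr0_norm// => hB.
  exists r, t; split => //.
    rewrite lt_neqAle rho_ge0// andbT; apply/eqP => h0; move: hB; rewrite -h0 mulr0.
    by rewrite leNgt ht.
  rewrite !(window_sum_eq0 _ hr) !subr0 !(window_sumE _ ht) bool_diff_norm//.
  apply: le_trans (_ : rho s t / 2 <= _); first by rewrite ler_pM2r// rho_mono.
  by move: hst; rewrite hs mul0r subr0 => /ltW.
- by move: hst; rewrite hs ht subrr normr0; lra.
Qed.

End Windows.

(** The sum is at most twice the larger term. *)
Lemma powR_add_le (R : realType) (p a b : R) : 0 <= p -> 0 <= a -> 0 <= b ->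
  (a + b) `^ p <= 2 `^ p * (a `^ p + b `^ p).
Proof.
move=> p0 a0 b0.
have h x y : 0 <= x -> 0 <= y -> x <= y -> (x + y) `^ p <= 2 `^ p * y `^ p.
  move=> x0 y0 xy; rewrite -powRM//; apply: ge0_ler_powR; rewrite ?nnegrE ?addr0 ?mulr_ge0 ?addr_ge0//.
  by lra.
have [ab|ba] := leP a b.
  by apply: le_trans (h a b a0 b0 ab) _; rewrite ler_pM2l ?powR_gt0// lerDr powR_ge0.
rewrite addrC; apply: le_trans (h b a b0 a0 (ltW ba)) _.
by rewrite ler_pM2l ?powR_gt0// lerDl powR_ge0.
Qed.

(** * Moduli of continuity given by a control *)

Section ControlModulus.
Variables (R : realType) (omega : R * R -> R) (p : R).
Hypothesis homega : control omega.
Hypothesis p_gt0 : 0 < p.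

Definition control_root s t : R := omega (s, t) `^ p^-1.

Lemma control_ge0 s t : 0 <= s -> s <= t -> t <= 1 -> 0 <= omega (s, t).
Proof. by move=> s0 st t1; have [_ h _ _] := homega; exact: h. Qed.

Lemma control_mono s s' t' t : 0 <= s -> s <= s' -> s' < t' -> t' <= t -> t <= 1 ->
  omega (s', t') <= omega (s, t).
Proof.
move=> s0 ss st tt t1; have [_ _ _ h] := homega.
have s1 : s' <= 1 by rewrite (le_trans (ltW st))// (le_trans tt).
have h1 : omega (s', t') <= omega (s, t').
  move: ss; rewrite le_eqVlt => /predU1P[->//|ss].
  apply: le_trans (h s s' t' s0 ss st (le_trans tt t1)).
  by rewrite lerDr control_ge0// ltW.
apply: le_trans h1 _.
move: tt; rewrite le_eqVlt => /predU1P[->//|tt].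
apply: le_trans (h s t' t s0 (le_lt_trans ss st) tt t1).
rewrite lerDl control_ge0//; last exact: ltW.
by rewrite (le_trans s0)// (le_trans ss) // ltW.
Qed.

Lemma control_root_mono s s' t' t : 0 <= s -> s <= s' -> s' < t' -> t' <= t -> t <= 1 ->
  control_root s' t' <= control_root s t.
Proof.
move=> s0 ss st tt t1; have s't' := ltW st.
have s't : s' <= t by exact: le_trans tt.
apply: ge0_ler_powR; rewrite ?nnegrE ?control_ge0//.
- by rewrite invr_ge0 ltW.
- exact: le_trans ss.
- exact: le_trans t1.
- exact: le_trans s't.
- exact: control_mono.
Qed.

(** Continuity of [omega] at the diagonal point (t, t), where it vanishes. *)
Lemma control_diag t e : 0 <= t <= 1 -> 0 < e -> exists2 d, 0 < d &
  forall x y, 0 <= x -> x < y -> y <= 1 -> `|x - t| < d -> `|y - t| < d ->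
    omega (x, y) < e.
Proof.
move=> /andP[t0 t1] e0; have [hc h0 hd _] := homega.
have /subspace_continuousP/(_ (t, t)) := hc.
rewrite /simplex/= => /(_ (And3 t0 (lexx t) t1)) /cvgrPdist_lt /(_ e e0).
rewrite near_withinE => -[[A B] /= [/nbhs_ballP[d1 d10 hA] /nbhs_ballP[d2 d20 hB]] hb].
exists (Num.min d1 d2); first by rewrite lt_min d10.
move=> x y x0 xy y1; rewrite !lt_min => /andP[hx _] /andP[_ hy].
have hAB : (A `*` B) (x, y).
  by split; [apply: hA|apply: hB]; rewrite /ball/= distrC.
have := hb _ hAB; rewrite /from_subspace hd ?t0// sub0r normrN => H.
apply: le_lt_trans (ler_norm _) _; apply: H.
by split => //; exact: ltW.
Qed.

Lemma control_modulus_continuous (f : R -> R) (C : R) :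
  (forall s t, 0 <= s -> s < t -> t <= 1 -> `|f t - f s| <= C * control_root s t) ->
  {within `[0, 1], continuous f}.
Proof.
move=> hf; apply: within_continuousP => t t01 e e0.
(* [C] carries no sign; this majorant is positive, so one may divide by it. *)
pose c := `|C| + 1; have c0 : 0 < c by rewrite ltr_wpDl.
have ec0 : 0 < e / c by rewrite divr_gt0.
have [d d0 hd] := control_diag t01 (powR_gt0 p ec0).
have key x y : 0 <= x -> x < y -> y <= 1 -> `|x - t| < d -> `|y - t| < d -> `|f y - f x| < e.
  move=> x0 xy y1 hx hy; apply: le_lt_trans (hf _ _ x0 xy y1) _.
  have r0 : 0 <= control_root x y by exact: powR_ge0.
  apply: (@le_lt_trans _ _ (c * control_root x y)).
    by rewrite ler_wpM2r// /c; have := ler_norm C; lra.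
  rewrite -ltr_pdivlMl// mulrC.
  have -> : e / c = ((e / c) `^ p) `^ p^-1.
    by rewrite -powRrM mulfV ?lt0r_neq0// powRr1// ltW.
  apply: gt0_ltr_powR; rewrite ?invr_gt0 ?nnegrE ?powR_ge0//; last exact: hd.
  by rewrite control_ge0// ltW.
exists d => // s /andP[s0 s1]; case/andP: t01 => t0 t1.
have tt : `|t - t| < d by rewrite subrr normr0.
case: (ltgtP s t) => [st|ts|->] hs; last by rewrite subrr normr0.
  by rewrite distrC; exact: key.
exact: key.
Qed.

End ControlModulus.

(** For [V = 0] the group is trivial, and for [omega = 0] only paths constant on [0, 1] are at
    finite distance from the constant path; the nontriviality hypotheses exclude such separable
    cases. *)
Theorem theorem24 (R : realType) (V : normedVectType R) (m : nat) (p : R)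
    (N : tens V -> R) (omega : R * R -> R)
    (hV : exists v : V, v <> 0) (hm : (1 <= m)%N) (hp : 1 <= p)
    (hN : homogeneous_norm m N) (homega : control omega) :
  ~ separable (Cpvar m N p) (dpvar m N p) /\
  ((exists2 x, Comega m N omega p x &
      exists2 t : R, t \in `[0, 1] & x t <> tone) ->
   ~ separable (Comega m N omega p) (domega m N omega p)).
Proof.
have [v v0] := hV; have K0 := line_norm_gt0 hm hN v0.
set K := line_norm m N v in K0 *; have K0' : 0 <= K by exact: ltW.
have p0 : 0 < p by exact: lt_le_trans hp.
have Gtone := fng1 V hm.
have inc_line (f : R -> R) s t : gdist m N (increment m (line m v \o f) s t) tone = `|f t - f s| * K.
  by rewrite increment_line// -(line0 hm v) gdist_line// sub0r normrN.
(* The distance between increments on the line is exactly the left side; the triangle inequality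
   goes through the increment of an arbitrary path [y]. *)
have tri (f g : R -> R) y s t : group_path m y -> 0 <= s <= 1 -> 0 <= t <= 1 ->
    `|(f t - f s) - (g t - g s)| * K <=
      gdist m N (increment m (line m v \o f) s t) (increment m y s t) +
      gdist m N (increment m (line m v \o g) s t) (increment m y s t).
  move=> hy hs ht; have Gy := fng_increment hm hy hs ht.
  rewrite !increment_line// -(gdist_line hm hN) gdistC; [|exact: hm|exact: hN|exact: fng_line|exact: fng_line].
  rewrite [X in _ <= _ + X]gdistC; [|exact: hm|exact: hN|exact: fng_line|exact: Gy].
  by apply: gdist_triangle => //; exact: fng_line.
split.
  have [c c0 [f [f0 fcont fF fsep]]] := scalar_family hp.
  (* Two p-th powers of [delta], multiplied by the factor 2^p of [powR_add_le], amount to half of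
     the separation K^p c. *)
  pose delta := K * (c / (4 * 2 `^ p)) `^ p^-1.
  have two0 : 0 < 2 `^ p :> R by exact: powR_gt0.
  have c4 : 0 < c / (4 * 2 `^ p) by rewrite divr_gt0// mulr_gt0.
  have delta0 : 0 < delta by rewrite mulr_gt0// powR_gt0.
  have deltap : 2 `^ p * (delta `^ p + delta `^ p) < K `^ p * c.
    rewrite /delta powRM ?powR_ge0 ?ltW// -powRrM mulVf ?lt0r_neq0// powRr1 ?ltW//.
    have -> : 2 `^ p * (K `^ p * (c / (4 * 2 `^ p)) + K `^ p * (c / (4 * 2 `^ p))) = K `^ p * c / 2.
      by field; rewrite lt0r_neq0.
    by have : 0 < K `^ p * c; [rewrite mulr_gt0// powR_gt0|lra].
  have hpath e : group_path m (line m v \o f e) by exact: line_path.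
  apply: (@not_separable R _ _ _ (fun e => line m v \o f e) delta) => // [e|e e' y ee' [hy _]].
    split=> //; have [F F1 hF] := fF e.
    apply: (@dpvar_fin _ _ _ _ _ hm hp _ (fun t => K `^ p * F t)).
      by move=> t /F1 ?; rewrite ler_pM2l// powR_gt0.
    move=> s t s0 st t1; rewrite inc_line powRM// mulrC -mulrBr ler_pM2l ?powR_gt0//.
    exact: hF.
  move=> h1 h2; have [M M0 hM] := fsep e e' ee'.
  have u1 := dpvar_uniform hp M0 (hpath e) hy (ltW delta0) h1.
  have u2 := dpvar_uniform hp M0 (hpath e') hy (ltW delta0) h2.
  have : K `^ p * c <= 2 `^ p * (delta `^ p + delta `^ p); last by rewrite leNgt deltap.
  have u12 := lerD u1 u2; rewrite -big_split/= in u12.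
  have hL := ler_wpM2l (ltW (powR_gt0 p K0)) hM.
  apply: (le_trans hL); apply: le_trans (ler_wpM2l (ltW two0) u12).
  rewrite [leRHS]mulr_sumr.
  rewrite mulr_sumr; apply: ler_sum_nat => i /andP[_ iM].
  set s := i%:R / _; set t := i.+1%:R / _.
  have s01 : 0 <= s <= 1.
    by rewrite divr_ge0//= ler_pdivrMr ?ltr0n// mul1r ler_nat ltnW.
  have t01 : 0 <= t <= 1.
    by rewrite divr_ge0//= ler_pdivrMr ?ltr0n// mul1r ler_nat.
  rewrite mulrC -powRM//.
  have G1 := fng_increment hm (hpath e) s01 t01.
  have G2 := fng_increment hm (hpath e') s01 t01.
  have G3 := fng_increment hm hy s01 t01.
  have d1 := gdist_ge0 hm hN G1 G3; have d2 := gdist_ge0 hm hN G2 G3.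
  apply: le_trans (powR_add_le (ltW p0) d1 d2).
  apply: ge0_ler_powR; rewrite ?nnegrE ?addr_ge0 ?mulr_ge0//; first exact: ltW.
  exact: tri.
move=> [x [hx xfin] [top top01 xtop]].
have tone_path : group_path m (fun=> tone : tens V).
  by split=> // w t; exact: cvg_cst.
have [C hC] : exists C : R, (domega m N omega p x (fun=> tone) < C%:E)%E.
  case: (domega m N omega p x (fun=> tone)) xfin => [r _|//|_].
    by exists (r + 1); rewrite lte_fin ltrDl.
  by exists 0; exact: ltNy0.
pose rho := control_root omega p.
have rho_ge0 s t : 0 <= s -> s < t -> t <= 1 -> 0 <= rho s t by move=> *; exact: powR_ge0.
have rho_mono := control_root_mono homega p0.
(* The norm along [x] is a real function that vanishes at 0, is positive at [top] and inherits the
   modulus of [x] through [hnorm_lip]. *)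
pose F t := N (x t).
have hG t : 0 <= t <= 1 -> free_nilpotent_group m (x t).
  by move=> ht; have [h _ _] := hx; apply: h; rewrite in_itv.
have F_rho s t : 0 <= s -> s < t -> t <= 1 -> `|F t - F s| <= C * rho s t.
  move=> s0 st t1.
  have s01 : 0 <= s <= 1 by apply/andP; split=> //; lra.
  have t01 : 0 <= t <= 1 by apply/andP; split=> //; lra.
  apply: le_trans (domega_lt hm hN hx tone_path hC s0 st t1 (control_ge0 homega s0 (ltW st) t1)).
  rewrite increment_tone// gdist_tone//; last exact: fng_increment.
  rewrite distrC; exact: hnorm_lip (hG _ s01) (hG _ t01).
have F_cont := control_modulus_continuous homega p0 F_rho.
have F0 : F 0 = 0 by have [_ _ h] := hx; rewrite /F h (hnorm1 hm hN).
have top01' : 0 <= top <= 1 by rewrite in_itv in top01.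
have Ftop : 0 < F top.
  rewrite lt_neqAle (hnorm_ge0 hN (hG _ top01')) andbT; apply/eqP => h.
  by have [_ h1 _ _ _] := hN; apply: xtop; apply/(h1 _ (hG _ top01')).
pose g e := window_sum rho F (F top) e.
have g_rho e := window_sum_rho rho_ge0 F_rho F_cont F0 top01' erefl Ftop e.
have g_sep := window_sum_separation rho_ge0 rho_mono F_rho F_cont F0 top01' erefl Ftop.
have gpath e : group_path m (line m v \o g e).
  apply: line_path => //; first exact: window_sum0 F0 Ftop e.
  exact: (control_modulus_continuous homega p0 (C := 2) (fun s t s0 st t1 => g_rho e s t s0 st t1)).
(* The separation is at least K rho / 2, whereas two distances below K / 8 account for at most K rho
   / 4. *)
have K8 : 0 < K / 8 by rewrite divr_gt0.
apply: (@not_separable R _ _ _ (fun e => line m v \o g e) (K / 8)) => // [e|e e' y ee' [hy _] h1 h2].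
  split=> //; apply: (@domega_fin _ _ _ _ _ hm _ _ (2 * K)) => s t s0 st t1.
  rewrite inc_line mulr_ge0//= mulrAC ler_pM2r//.
  exact: g_rho.
have [s [t [s0 st t1 r0 hst]]] := g_sep _ _ ee'.
have o0 := control_ge0 homega s0 (ltW st) t1.
have b1 := domega_lt hm hN (gpath e) hy h1 s0 st t1 o0.
have b2 := domega_lt hm hN (gpath e') hy h2 s0 st t1 o0.
have s01 : 0 <= s <= 1 by apply/andP; split=> //; lra.
have t01 : 0 <= t <= 1 by apply/andP; split=> //; lra.
have := tri (g e) (g e') y s t hy s01 t01.
apply/negP; rewrite -ltNge; apply: le_lt_trans (lerD b1 b2) _.
rewrite -[omega (s, t) `^ _]/(rho s t).
apply: lt_le_trans (_ : rho s t / 2 * K <= _); last by rewrite ler_pM2r.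
have rK : 0 < rho s t * K by rewrite mulr_gt0.
have -> : K / 8 * rho s t + K / 8 * rho s t = rho s t * K / 4 by field.
have -> : rho s t / 2 * K = rho s t * K / 2 by field.
lra.
Qed.
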